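(* Let $G$ be a finitely generated group of polynomial or exponential growth and let $p,q \in (1,\infty)$ with $p<q$. Then the canonical homomorphism $H_*^p(G) \longrightarrow H_*^q(G)$ is an isomorphism.
   Context: $\mathbb{N}=\{0,1,2,\dots\}$, and $0^0=1$. For a group $G$, let $C_*(G;\mathbb{C})$ be the bar complex: $C_k(G;\mathbb{C})$ is the $\mathbb{C}$-vector space with basis the symbols $[e,g_1,\dots,g_k]$, $(g_1,\dots,g_k)\in G^k$. For $x_0,\dots,x_k\in G$ put $[x_0,x_1,\dots,x_k] := [e,x_0^{-1}x_1,\dots,x_0^{-1}x_k]$. The boundary operator is $\partial [x_0,\dots,x_k] = \sum_{j=0}^k (-1)^j [x_0,\dots,\widehat{x_j},\dots,x_k]$. Let $G$ be finitely generated, $S$ a finite generating set, $d_S$ the (left-invariant) word metric, and for $g=(g_1,\dots,g_k)\in G^k$ let $\operatorname{diam}_S(g) := \operatorname{diam}_S\{e,g_1,\dots,g_k\}$ be the diameter with respect to $d_S$. For $n\in\mathbb{N}$, $p\in[1,\infty)$ and $c=\sum_{g\in G^k} a_g\,[e,g_1,\dots,g_k]\in C_k(G;\mathbb{C})$ let $$\|c\|_{n,p}^S := \Bigl(\sum_{g\in G^k}|a_g|^p\cdot \operatorname{diam}_S(g)^n\Bigr)^{1/p}.$$ $C_k^p(G)$ denotes the Fréchet space obtained by completing $C_k(G;\mathbb{C})$ with respect to the family $(\|\cdot\|_{n,p}^S+\|\partial\,\cdot\|_{n,p}^S)_{n\in\mathbb{N}}$. The boundary operator extends continuously, $C_*^p(G)$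 is a chain complex, independent of $S$, and $H_*^p(G)$ denotes its homology. For $p<q$, the identity of $C_*(G;\mathbb{C})$ extends to a continuous chain map $C_*^p(G)\to C_*^q(G)$; the canonical homomorphism $H_*^p(G)\to H_*^q(G)$ is the map induced on homology. Growth: let $\beta_{G,S}(r)$ be the number of elements $g\in G$ with $d_S(e,g)\le r$. $G$ has polynomial growth if there are $D\in\mathbb{N}$, $K>0$ with $\beta_{G,S}(r)\le K r^D$ for all $r\in\mathbb{N}_{>0}$; $G$ has exponential growth if there is $\alpha>1$ with $\beta_{G,S}(r)\ge\alpha^r$ for all $r\in\mathbb{N}$. *)

(* Defs.v *)
From HB Require Import structures.
From mathcomp Require Import all_boot all_order all_algebra finmap.
From mathcomp Require Import boolp classical_sets functions cardinality.
From mathcomp Require Import interval_inference reals convex exp hoelder.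
From mathcomp Require Import zify complex monalg.

Set Implicit Arguments.
Unset Strict Implicit.
Unset Printing Implicit Defensive.

Import Order.TTheory GRing.Theory Num.Theory.
Import Normc.

Local Open Scope ring_scope.
Local Open Scope quotient_scope.

Record subspace (R : pzRingType) (V : lmodType R) := Subspace {
  subspace_pred :> {pred V};
  subspaceP : submod_closed subspace_pred }.

HB.instance Definition _ (R : pzRingType) (V : lmodType R) (U : subspace V) :=
  GRing.isSubmodClosed.Build R V (subspace_pred U) (subspaceP U).

(* Quotient.quot is only equipped with an additive group structure by the
   library; here it becomes a module when U is a submodule. *)
Section QuotientModule.
Variables (R : pzRingType) (V : lmodType R) (U : subspace V).
Local Notation Q := (Quotient.quot (subspace_pred U)).

Lemma quot_eqP (u v : V) : (\pi_Q u == \pi_Q v) = (u - v \in subspace_pred U).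
Proof. by rewrite -Quotient.idealrBE. Qed.

Lemma pi_add (u v : V) : \pi_Q (u + v) = \pi_Q u + \pi_Q v.
Proof. exact: raddfD. Qed.

Definition quot_scale (a : R) (u : Q) : Q := \pi_Q (a *: repr u).

Lemma pi_scale a v : quot_scale a (\pi_Q v) = \pi_Q (a *: v).
Proof.
apply/eqP; rewrite quot_eqP -scalerBr rpredZ//.
by rewrite -quot_eqP reprK.
Qed.

Fact quot_scaleA a b u : quot_scale a (quot_scale b u) = quot_scale (a * b) u.
Proof. by rewrite -[u]reprK (pi_scale b) !(pi_scale _ (repr u)) pi_scale scalerA. Qed.

Fact quot_scale1 : left_id 1 quot_scale.
Proof. by move=> u; rewrite -[u]reprK pi_scale scale1r. Qed.

Fact quot_scaleDr : right_distributive quot_scale +%R.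
Proof.
move=> a u v; rewrite -[u]reprK -[v]reprK -pi_add.
by rewrite pi_scale !(pi_scale a) scalerDr pi_add.
Qed.

Fact quot_scaleDl u : {morph quot_scale^~ u : a b / a + b}.
Proof. by move=> a b; rewrite -[u]reprK !(pi_scale _ (repr u)) scalerDl pi_add. Qed.

HB.instance Definition _ := GRing.Zmodule_isLmodule.Build R Q
  quot_scaleA quot_scale1 quot_scaleDr quot_scaleDl.

End QuotientModule.

(* For submodules Z, B of V, the module Z / (Z `&` B); in all uses B is
   contained in Z. *)
Section Subquotient.
Variables (R : pzRingType) (V : lmodType R) (Z B : subspace V).

Record submod := Submod { submod_val :> V; _ : submod_val \in subspace_pred Z }.
HB.instance Definition _ := [isSub for submod_val].
HB.instance Definition _ := [Choice of submod by <:].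
HB.instance Definition _ := [SubChoice_isSubLmodule of submod by <:].

Definition submod_restr : {pred submod} := fun z => val z \in subspace_pred B.
Fact submod_restr_closed : submod_closed submod_restr.
Proof.
have [B0 Blin] := subspaceP B; split=> [//|a u v uB vB]; exact: Blin.
Qed.

Local Notation B_Z := (subspace_pred (Subspace submod_restr_closed)).

Definition subquo := Quotient.quot B_Z.
HB.instance Definition _ := GRing.Lmodule.on subquo.

Definition subquo_pi (z : submod) : subquo := \pi_(Quotient.quot B_Z) z.

Lemma subquo_pi_linear : linear subquo_pi.
Proof. by move=> a u v; rewrite /subquo_pi pi_add -pi_scale. Qed.
HB.instance Definition _ := GRing.isLinear.Build R submod subquo *:%R subquo_pi
  subquo_pi_linear.

Lemma subquo_piP u v :
  (subquo_pi u = subquo_pi v) <-> (val u - val v \in subspace_pred B).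
Proof.
rewrite -[_ - _ \in _]/(u - v \in B_Z) -quot_eqP.
by split=> [H|/eqP//]; apply/eqP.
Qed.

Lemma subquo_reprK (x : subquo) : subquo_pi (repr x) = x.
Proof. exact: reprK. Qed.

End Subquotient.

Section SubquotientMap.
Variables (R : pzRingType) (V W : lmodType R).
Variables (Z B : subspace V) (Z' B' : subspace W) (f : {linear V -> W}).
Hypothesis fZ : {homo f : v / v \in subspace_pred Z >-> v \in subspace_pred Z'}.
Hypothesis fB : {homo f : v / v \in subspace_pred B >-> v \in subspace_pred B'}.

Definition submod_map (z : submod Z) : submod Z' := Submod (fZ (valP z)).

Definition subquo_map of {homo f : v / v \in subspace_pred B >->
    v \in subspace_pred B'} := fun x : subquo Z B => subquo_pi B' (submod_map (repr x)).

Lemma subquo_map_pi z :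
  subquo_map fB (subquo_pi B z) = subquo_pi B' (submod_map z).
Proof.
apply/subquo_piP => /=; rewrite -raddfB; apply: fB.
by apply/subquo_piP; rewrite subquo_reprK.
Qed.

Lemma subquo_map_linear : linear (subquo_map fB).
Proof.
move=> a u v; rewrite -[u]subquo_reprK -[v]subquo_reprK -linearP.
rewrite !subquo_map_pi -linearP; congr subquo_pi.
by apply/val_inj; rewrite /= linearP.
Qed.
HB.instance Definition _ := GRing.isLinear.Build R (subquo Z B) (subquo Z' B')
  *:%R (subquo_map fB) subquo_map_linear.

End SubquotientMap.

Section Homology.
Variables (R : pzRingType) (U V W : lmodType R).
Variables (f : {linear U -> V}) (g : {linear V -> W}).

Definition ker_pred : {pred V} := fun v => g v == 0.
Fact ker_closed : submod_closed ker_pred.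
Proof.
split=> [|a u v]; rewrite !unfold_in /ker_pred ?linear0// linearP.
by move=> /eqP-> /eqP->; rewrite scaler0 addr0.
Qed.
Definition ker := Subspace ker_closed.

Definition im_pred : {pred V} := fun v => `[< exists u, v = f u >].
Fact im_closed : submod_closed im_pred.
Proof.
split=> [|a u v]; rewrite !unfold_in /im_pred.
  by apply/asboolP; exists 0; rewrite linear0.
move=> /asboolP[x ->] /asboolP[y ->]; apply/asboolP.
by exists (a *: x + y); rewrite linearP.
Qed.
Definition im := Subspace im_closed.

Definition homology := subquo ker im.
HB.instance Definition _ := GRing.Lmodule.on homology.

End Homology.

Section Seminorms.
Variable R : realType.

Lemma normc_ge0 (z : R[i]) : 0 <= normc z.
Proof. by case: z => a b; exact: sqrtr_ge0. Qed.

Record seminorms (V : lmodType R[i]) := Seminorms {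
  seminorm :> nat -> V -> R;
  seminormD : forall n u v, seminorm n (u + v) <= seminorm n u + seminorm n v;
  seminormZ : forall n a v, seminorm n (a *: v) = normc a * seminorm n v }.

Section Theory.
Variables (V : lmodType R[i]) (N : seminorms V).

Lemma seminorm0 n : N n 0 = 0.
Proof. by rewrite -(scale0r (0 : V)) seminormZ normc0 mul0r. Qed.

Lemma seminormN n v : N n (- v) = N n v.
Proof. by rewrite -scaleN1r seminormZ normcN normc1 mul1r. Qed.

Lemma seminorm_ge0 n v : 0 <= N n v.
Proof.
have := seminormD N n v (- v); rewrite subrr seminorm0 seminormN -mulr2n.
by rewrite pmulrn_lge0.
Qed.

Definition cauchy_pred : {pred nat -> V} := fun u =>
  `[< forall n e, 0 < e ->
        exists M, forall i j, (M <= i)%N -> (M <= j)%N -> N n (u i - u j) < e >].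

Definition null_pred : {pred nat -> V} := fun u =>
  `[< forall n e, 0 < e -> exists M, forall i, (M <= i)%N -> N n (u i) < e >].

Lemma lt_comb n a (x y : V) e : 0 < e -> N n x < e / (2 * (normc a + 1)) ->
  N n y < e / 2 -> N n (a *: x + y) < e.
Proof.
move=> e0 xe ye; apply: le_lt_trans (seminormD _ _ _ _) _.
rewrite seminormZ (splitr e) ler_ltD//.
have a1 : 0 < normc a + 1 by rewrite ltr_wpDl// normc_ge0.
apply: (@le_trans _ _ ((normc a + 1) * (e / (2 * (normc a + 1))))).
  by apply: ler_pM; rewrite ?normc_ge0 ?seminorm_ge0 ?lerDl ?ler01 ?ltW.
by rewrite invfM [e * _]mulrA mulrCA divff ?mulr1// gt_eqF.
Qed.

Fact cauchy_closed : submod_closed cauchy_pred.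
Proof.
split=> [|a u v]; rewrite !unfold_in /cauchy_pred.
  by apply/asboolP => n e e0; exists 0 => i j _ _; rewrite subrr seminorm0.
move=> /asboolP uC /asboolP vC; apply/asboolP => n e e0.
have a1 : 0 < normc a + 1 by rewrite ltr_wpDl// normc_ge0.
have [|M uM] := uC n (e / (2 * (normc a + 1))); first by rewrite divr_gt0 ?mulr_gt0.
have [|M' vM] := vC n (e / 2); first by rewrite divr_gt0.
exists (maxn M M') => i j; rewrite !geq_max => /andP[Mi M'i] /andP[Mj M'j].
rewrite !fctE opprD addrACA -scalerBr.
by apply: lt_comb => //; [apply: uM | apply: vM].
Qed.
Definition cauchy := Subspace cauchy_closed.

Fact null_closed : submod_closed null_pred.
Proof.
split=> [|a u v]; rewrite !unfold_in /null_pred.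
  by apply/asboolP => n e e0; exists 0 => i _; rewrite seminorm0.
move=> /asboolP uC /asboolP vC; apply/asboolP => n e e0.
have a1 : 0 < normc a + 1 by rewrite ltr_wpDl// normc_ge0.
have [|M uM] := uC n (e / (2 * (normc a + 1))); first by rewrite divr_gt0 ?mulr_gt0.
have [|M' vM] := vC n (e / 2); first by rewrite divr_gt0.
exists (maxn M M') => i; rewrite !geq_max => /andP[Mi M'i].
by rewrite !fctE; apply: lt_comb => //; [apply: uM | apply: vM].
Qed.
Definition null := Subspace null_closed.

(* The Hausdorff completion: Cauchy sequences modulo null sequences; sequences
   suffice because the family of seminorms is countable. *)
Definition completion := subquo cauchy null.
HB.instance Definition _ := GRing.Lmodule.on completion.

End Theory.

Section CompletionMap.
Variables (V W : lmodType R[i]) (N : seminorms V) (N' : seminorms W).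
Variable f : {linear V -> W}.

Definition continuous_for :=
  forall n, exists m C, forall v, N' n (f v) <= C * N m v.

Hypothesis f_cont : continuous_for.

Lemma continuous_for_small n e : 0 < e ->
  exists m d, 0 < d /\ forall v, N m v < d -> N' n (f v) < e.
Proof.
move=> e0; have [m [C fC]] := f_cont n.
have C1 : 0 < `|C| + 1 by rewrite ltr_wpDl.
exists m, (e / (`|C| + 1)); split=> [|v vd]; first by rewrite divr_gt0.
apply: (le_lt_trans (fC v)); apply: (@le_lt_trans _ _ ((`|C| + 1) * N m v)).
  by rewrite ler_wpM2r ?seminorm_ge0// ler_wpDr// ler_norm.
by rewrite mulrC -ltr_pdivlMr.
Qed.

Definition seq_map (u : nat -> V) : nat -> W := f \o u.
Fact seq_map_linear : linear seq_map.
Proof. by move=> a u v; apply/funext => i; rewrite /seq_map /= linearP. Qed.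
HB.instance Definition _ := GRing.isLinear.Build R[i] (nat -> V) (nat -> W)
  *:%R seq_map seq_map_linear.

Fact seq_map_cauchy : {homo seq_map : u / u \in subspace_pred (cauchy N) >->
  u \in subspace_pred (cauchy N')}.
Proof.
move=> u; rewrite !unfold_in => /asboolP uC; apply/asboolP => n e e0.
have [m [d [d0 fd]]] := continuous_for_small n e0.
have [M uM] := uC m d d0; exists M => i j Mi Mj.
by rewrite /seq_map /= -linearB fd ?uM.
Qed.

Fact seq_map_null : {homo seq_map : u / u \in subspace_pred (null N) >->
  u \in subspace_pred (null N')}.
Proof.
move=> u; rewrite !unfold_in => /asboolP uC; apply/asboolP => n e e0.
have [m [d [d0 fd]]] := continuous_for_small n e0.
by have [M uM] := uC m d d0; exists M => i Mi; rewrite /seq_map /= fd ?uM.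
Qed.

(* The continuous extension of f to the completions. *)
Definition completion_map : completion N -> completion N' :=
  subquo_map seq_map_cauchy seq_map_null.
HB.instance Definition _ := GRing.Linear.on completion_map.

End CompletionMap.
End Seminorms.

Section LpNorm.
Variables (R : realType) (T : eqType) (s : seq T) (w : T -> R) (p : R).
Hypotheses (w_ge0 : forall x, 0 <= w x) (p_ge1 : 1 <= p).

Definition lpnorm (a : T -> R) : R := (\sum_(x <- s) a x `^ p * w x) `^ p^-1.

Let p_gt0 : 0 < p. Proof. exact: lt_le_trans p_ge1. Qed.
Let p_neq0 : p != 0. Proof. by rewrite gt_eqF. Qed.

Lemma lpsum_ge0 a : 0 <= \sum_(x <- s) a x `^ p * w x.
Proof. by apply: sumr_ge0 => x _; rewrite mulr_ge0 ?powR_ge0. Qed.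

Lemma lpnorm_ge0 a : 0 <= lpnorm a.
Proof. exact: powR_ge0. Qed.

Lemma lpnormK a : lpnorm a `^ p = \sum_(x <- s) a x `^ p * w x.
Proof. by rewrite /lpnorm -powRrM mulVf ?gt_eqF// powRr1// lpsum_ge0. Qed.

Lemma lpnorm_le a A : 0 <= A ->
  \sum_(x <- s) a x `^ p * w x <= A `^ p -> lpnorm a <= A.
Proof.
move=> A0 aA; rewrite -[leRHS]powRr1// -[X in _ `^ X](divff p_neq0).
rewrite powRrM; apply: ge0_ler_powR; rewrite ?nnegrE ?invr_ge0 ?powR_ge0//.
- exact: ltW.
- exact: lpsum_ge0.
Qed.

Lemma lpsum_le a A : lpnorm a <= A -> \sum_(x <- s) a x `^ p * w x <= A `^ p.
Proof.
move=> aA; rewrite -lpnormK; apply: ge0_ler_powR => //; rewrite ?nnegrE.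
- exact: ltW.
- exact: lpnorm_ge0.
- exact: le_trans (lpnorm_ge0 _) aA.
Qed.

Lemma lpnorm_mono a b :
  (forall x, 0 <= a x <= b x) -> lpnorm a <= lpnorm b.
Proof.
move=> ab; apply: lpnorm_le; first exact: lpnorm_ge0.
rewrite lpnormK; apply: ler_sum => x _; have /andP[a0 ax] := ab x.
apply: ler_wpM2r => //; apply: ge0_ler_powR => //; rewrite ?nnegrE//.
- exact: ltW.
- exact: le_trans ax.
Qed.

Lemma lpnormZ c a : 0 <= c -> (forall x, 0 <= a x) ->
  lpnorm (fun x => c * a x) = c * lpnorm a.
Proof.
move=> c0 a0; rewrite /lpnorm.
under eq_bigr => x _ do rewrite powRM// -mulrA.
rewrite -mulr_sumr powRM ?powR_ge0 ?lpsum_ge0//.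
by rewrite -powRrM divff ?gt_eqF// powRr1.
Qed.

Lemma convex_powR_comb x y A B : 0 < A -> 0 < B -> 0 <= x -> 0 <= y ->
  ((x + y) / (A + B)) `^ p <=
    A / (A + B) * (x / A) `^ p + B / (A + B) * (y / B) `^ p.
Proof.
move=> A0 B0 x0 y0; have AB0 : 0 < A + B by rewrite addr_gt0.
have t0 : 0 <= A / (A + B) by rewrite divr_ge0 ?ltW.
have t1 : A / (A + B) <= 1 by rewrite ler_pdivrMr// mul1r lerDl ltW.
have Ht : 1 - A / (A + B) = B / (A + B).
  by rewrite -[X in X - _](divff (lt0r_neq0 AB0)) -mulrBl addrC addKr.
have := @convex_powR R p p_ge1 (Itv01 t0 t1) (x / A) (y / B).
rewrite !inE /= !in_itv /= !andbT.
move=> /(_ (divr_ge0 x0 (ltW A0)) (divr_ge0 y0 (ltW B0))).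
rewrite !convRE /= -[X in (_ + X * _) `^ _]/(1 - _) -[X in _ <= _ + X * _]/(1 - _).
rewrite Ht; apply: le_trans.
suff -> : A / (A + B) * (x / A) + B / (A + B) * (y / B) = (x + y) / (A + B) by [].
rewrite mulrAC [A * _]mulrC divfK ?gt_eqF//.
by rewrite [B / _ * _]mulrAC [B * _]mulrC divfK ?gt_eqF// mulrDl.
Qed.

Lemma lpnormD_bound a b A B : (forall x, 0 <= a x) -> (forall x, 0 <= b x) ->
  0 < A -> 0 < B -> lpnorm a <= A -> lpnorm b <= B ->
  lpnorm (fun x => a x + b x) <= A + B.
Proof.
move=> a0 b0 A0 B0 aA bB; have AB0 : 0 < A + B by rewrite addr_gt0.
apply: lpnorm_le; first exact: ltW.
have divK c C : 0 < C -> (forall x, 0 <= c x) -> lpnorm c <= C ->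
    \sum_(x <- s) (c x / C) `^ p * w x <= 1.
  move=> C0 c0 /lpsum_le cC.
  under eq_bigr => x _ do rewrite powRM ?invr_ge0 ?(ltW C0)// mulrAC.
  rewrite -mulr_suml -powR_inv1 ?(ltW C0)// -powRrM mulrC mulN1r powRN.
  by rewrite mulrC ler_pdivrMr ?powR_gt0// mul1r.
have -> : \sum_(x <- s) (a x + b x) `^ p * w x =
    (A + B) `^ p * \sum_(x <- s) ((a x + b x) / (A + B)) `^ p * w x.
  rewrite mulr_sumr; apply: eq_bigr => x _; rewrite mulrA -powRM ?(ltW AB0)//.
    by rewrite [(A + B) * _]mulrC divfK ?gt_eqF.
  by apply: divr_ge0; [apply: addr_ge0 | apply: ltW].
rewrite ler_piMr ?powR_ge0//.
apply: (@le_trans _ _ (\sum_(x <- s)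
    (A / (A + B) * ((a x / A) `^ p * w x) +
     B / (A + B) * ((b x / B) `^ p * w x)))).
  apply: ler_sum => x _; rewrite !mulrA -mulrDl ler_wpM2r//.
  exact: convex_powR_comb.
rewrite big_split /= -!mulr_sumr.
have -> : 1 = A / (A + B) * 1 + B / (A + B) * 1 :> R.
  by rewrite !mulr1 -mulrDl divff ?gt_eqF.
apply: lerD; apply: ler_wpM2l; rewrite ?divr_ge0 ?(ltW A0) ?(ltW B0) ?(ltW AB0)//.
  exact: divK.
exact: divK.
Qed.

Lemma lpnormD a b : (forall x, 0 <= a x) -> (forall x, 0 <= b x) ->
  lpnorm (fun x => a x + b x) <= lpnorm a + lpnorm b.
Proof.
move=> a0 b0; apply/ler_addgt0Pr => e e0.
have e20 : 0 < e / 2 by rewrite divr_gt0.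
rewrite [e]splitr addrACA; apply: lpnormD_bound => //.
- by rewrite ltr_wpDl// lpnorm_ge0.
- by rewrite ltr_wpDl// lpnorm_ge0.
- by rewrite lerDl ltW.
- by rewrite lerDl ltW.
Qed.

Lemma lpnorm_exponent q a : p <= q -> (forall x, w x = 0 \/ 1 <= w x) ->
  (forall x, 0 <= a x) ->
  (\sum_(x <- s) a x `^ q * w x) `^ q^-1 <= lpnorm a.
Proof.
move=> pq w01 a0; have q0 : 0 < q by exact: lt_le_trans pq.
rewrite -[leRHS]powRr1 ?lpnorm_ge0// -[X in _ <= _ `^ X](divff (lt0r_neq0 q0)).
rewrite powRrM; apply: ge0_ler_powR; rewrite ?nnegrE ?invr_ge0 ?powR_ge0//.
- exact: ltW.
- by apply: sumr_ge0 => x _; rewrite mulr_ge0 ?powR_ge0.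
have -> : lpnorm a `^ q = lpnorm a `^ (q - p) * lpnorm a `^ p.
  by rewrite -powRD ?subrK// gt_eqF.
rewrite lpnormK mulr_sumr.
rewrite big_seq [leRHS]big_seq; apply: ler_sum => x xs.
have [->|w1] := w01 x; first by rewrite !mulr0.
rewrite mulrA ler_wpM2r//.
have -> : a x `^ q = a x `^ (q - p) * a x `^ p.
  by rewrite -powRD ?subrK// gt_eqF.
rewrite ler_wpM2r ?powR_ge0// ge0_ler_powR ?subr_ge0 ?nnegrE ?lpnorm_ge0//.
rewrite -[leLHS](powRr1 (a0 x)) -(divff p_neq0) powRrM.
apply: ge0_ler_powR; rewrite ?nnegrE ?invr_ge0 ?powR_ge0 ?lpsum_ge0 ?(ltW p_gt0)//.
rewrite (big_rem x)//=; apply: (@le_trans _ _ (a x `^ p * w x)).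
  by rewrite ler_peMr ?powR_ge0.
by rewrite lerDl sumr_ge0// => y _; rewrite mulr_ge0 ?powR_ge0.
Qed.

End LpNorm.

Section WordMetric.
Variables (G : groupType) (S : {fset G}).

Definition is_word (n : nat) (g : G) : Prop :=
  exists s : seq G, [/\ size s = n,
    all (fun x => (x \in S) || (x^-1%g \in S)) s & g = (\prod_(x <- s) x)%g].

Definition generates : Prop := forall g, exists n, is_word n g.

(* Word length; the value 0 outside the subgroup generated by S is junk. *)
Definition word_length (g : G) : nat :=
  match pselect (exists n, `[< is_word n g >]) with
  | left ex => ex_minn ex
  | right _ => 0
  end.

Definition word_dist (x y : G) : nat := word_length (x^-1 * y)%g.

(* The diameter of {e, g_1, ..., g_k}. *)
Definition diam k (g : k.-tuple G) : nat :=
  \max_(x <- 1%g :: g) \max_(y <- 1%g :: g) word_dist x y.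

Definition growth (r : nat) : nat :=
  #|` fset_set [set g | (word_dist 1%g g <= r)%N] |.

Definition polynomial_growth (R : realType) : Prop :=
  exists (D : nat) (K : R), 0 < K /\
    forall r, (0 < r)%N -> (growth r)%:R <= K * r%:R ^+ D.

Definition exponential_growth (R : realType) : Prop :=
  exists alpha : R, 1 < alpha /\ forall r, alpha ^+ r <= (growth r)%:R.

End WordMetric.

Section BarComplex.
Variables (R : realType) (G : groupType).

(* The basis symbol [e, g_1, ..., g_k] is represented by (g_1, ..., g_k). *)
Definition chain (k : nat) := {malg R[i][k.-tuple G]}.
HB.instance Definition _ k := GRing.Lmodule.on (chain k).

Definition vertex k (g : k.-tuple G) : 'I_k.+1 -> G :=
  tnth [tuple of 1%g :: g].

(* [x_0, ..., x_k] = [e, x_0^-1 x_1, ..., x_0^-1 x_k] *)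
Definition bracket k (x : 'I_k.+1 -> G) : k.-tuple G :=
  [tuple ((x ord0)^-1 * x (lift ord0 i))%g | i < k].

Definition symbol k (x : 'I_k.+1 -> G) : chain k := << bracket x >>.

Definition simplex_boundary k (x : 'I_k.+2 -> G) : chain k :=
  \sum_(j < k.+2) (-1) ^+ j *: symbol (x \o lift j).

Definition chain_boundary k (c : chain k.+1) : chain k :=
  \sum_(g <- msupp c) c@_g *: simplex_boundary (vertex g).

Lemma chain_boundaryEw k (c : chain k.+1) (D : {fset k.+1.-tuple G}) :
  (msupp c `<=` D)%fset ->
  chain_boundary c = \sum_(g <- D) c@_g *: simplex_boundary (vertex g).
Proof.
move=> cD; rewrite /chain_boundary; apply: big_fset_incl => // g _ gc.
by rewrite mcoeff_outdom// scale0r.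
Qed.

Lemma chain_boundary_linear k : linear (@chain_boundary k).
Proof.
move=> a u v; pose D := (msupp u `|` msupp v `|` msupp (a *: u + v))%fset.
rewrite !(@chain_boundaryEw _ _ D).
- rewrite scaler_sumr -big_split; apply: eq_bigr => g _ /=.
  by rewrite mcoeffD mcoeffZ scalerDl scalerA.
- by rewrite /D -fsetUA fsetUCA fsubsetUl.
- by rewrite /D -fsetUA fsubsetUl.
- by rewrite /D fsubsetUr.
Qed.
HB.instance Definition _ k := GRing.isLinear.Build R[i] (chain k.+1) (chain k)
  *:%R (@chain_boundary k) (@chain_boundary_linear k).

(* C_{-1} = 0 is encoded by the zero map C_0 -> C_0 (note 0.-1 = 0). *)
Definition boundary (k : nat) : {linear chain k -> chain k.-1} :=
  match k with
  | 0 => \0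
  | k'.+1 => @chain_boundary k'
  end.

Lemma vertex_bracket k (x : 'I_k.+1 -> G) i :
  vertex (bracket x) i = ((x ord0)^-1 * x i)%g.
Proof.
rewrite /vertex; case: (unliftP ord0 i) => [j ->|->].
  by rewrite tnthS tnth_mktuple.
by rewrite tnth0 mulVg.
Qed.

Lemma symbol_shift k (x : 'I_k.+1 -> G) (g : G) :
  symbol (fun i => (g * x i)%g) = symbol x.
Proof.
congr (<< _ >>); apply: eq_from_tnth => i; rewrite !tnth_mktuple.
by rewrite invgM -mulgA mulKg.
Qed.

Lemma boundary_symbol k (x : 'I_k.+2 -> G) :
  boundary k.+1 (symbol x) = simplex_boundary x.
Proof.
rewrite /= (@chain_boundaryEw _ _ [fset bracket x]%fset) ?msuppU_le//.
rewrite big_seq_fset1 mcoeffUU scale1r; apply: eq_bigr => j _; congr (_ *: _).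
rewrite -[RHS](symbol_shift _ (x ord0)^-1%g); congr symbol.
by apply/funext => i; rewrite /= vertex_bracket.
Qed.

(* (j, i) |-> (j', i') such that lift j \o lift i = lift j' \o lift i' and the
   signs (-1) ^+ (j + i), (-1) ^+ (j' + i') are opposite. *)
Definition swap_faces k (t : 'I_k.+3 * 'I_k.+2) : 'I_k.+3 * 'I_k.+2 :=
  let: (j, i) := t in
  if (i < j)%N then (inord i, inord j.-1) else (inord i.+1, inord j).

Lemma swap_facesP k (t : 'I_k.+3 * 'I_k.+2) :
  [/\ swap_faces (swap_faces t) = t,
      odd ((swap_faces t).1 + (swap_faces t).2) = ~~ odd (t.1 + t.2) &
      lift (swap_faces t).1 \o lift (swap_faces t).2 =1 lift t.1 \o lift t.2].
Proof.
case: t => j i; have := ltn_ord j; have := ltn_ord i; rewrite /swap_faces.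
case: ifPn => ij ik jk /=.
  have ji : ((inord i : 'I_k.+3) = i :> nat) /\ ((inord j.-1 : 'I_k.+2) = j.-1 :> nat).
    by split; rewrite inordK//; lia.
  case: ji => Ei Ej; rewrite Ei Ej; split.
  - rewrite ifN; last by lia.
    by congr pair; apply/val_inj; rewrite /= inordK; lia.
  - by lia.
  - move=> l; apply/val_inj; rewrite /= /bump Ei Ej; lia.
have ji : ((inord i.+1 : 'I_k.+3) = i.+1 :> nat) /\ ((inord j : 'I_k.+2) = j :> nat).
  by split; rewrite inordK//; lia.
case: ji => Ei Ej; rewrite Ei Ej; split.
- rewrite ifT; last by lia.
  by congr pair; apply/val_inj; rewrite /= inordK; lia.
- by lia.
- move=> l; apply/val_inj; rewrite /= /bump Ei Ej; lia.
Qed.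

Lemma sign_swap (K : pzRingType) (a b c d : nat) :
  odd (a + b) = ~~ odd (c + d) ->
  (-1) ^+ a * (-1) ^+ b = - ((-1) ^+ c * (-1) ^+ d) :> K.
Proof. by move=> sgn; rewrite -!exprD -signr_odd sgn signrN signr_odd. Qed.

Lemma boundary_simplex_boundary k (x : 'I_k.+3 -> G) :
  boundary k.+1 (simplex_boundary x) = 0.
Proof.
rewrite [in X in boundary _ X]/simplex_boundary linear_sum.
transitivity (\sum_(j < k.+3) \sum_(i < k.+2) ((-1) ^+ j : R[i]) *:
    (((-1) ^+ i : R[i]) *: symbol ((x \o lift j) \o lift i))).
  by apply: eq_bigr => j _; rewrite linearZ_LR -scaler_sumr boundary_symbol.
rewrite pair_bigA /=.
set F := BIG_F; pose s : chain k := \sum_t F t.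
suff sN : s = - s.
  have : (2 : R[i]) *: s = 0 by rewrite scaler_nat mulr2n {1}sN addNr.
  have two0 : (2 : R[i]) != 0 by rewrite pnatr_eq0.
  by move=> s0; rewrite -[LHS]scale1r -(mulVf two0) -scalerA s0 scaler0.
rewrite -sumrN {1}/s (reindex_inj (inv_inj (fun t => (let: And3 H _ _ := @swap_facesP k t in H)))).
apply: eq_bigr => t _; have [_ sgn fac] := swap_facesP t.
rewrite /F !scalerA (sign_swap _ sgn) scaleNr.
by congr (- (_ *: symbol _)); apply/funext => l; exact: congr1 (fac l).
Qed.

Lemma boundaryK k (c : chain k) : boundary k.-1 (boundary k c) = 0.
Proof.
case: k c => [|[|k]] c //; rewrite [boundary k.+2 c]/= /chain_boundary.
rewrite linear_sum big1_seq// => g _.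
by rewrite linearZ_LR boundary_simplex_boundary scaler0.
Qed.

End BarComplex.

Section LpHomology.
Variables (R : realType) (G : groupType) (S : {fset G}).
Local Notation chain := (chain R G).

Definition chain_norm (p : R) (n k : nat) (c : chain k) : R :=
  (\sum_(g <- msupp c) normc c@_g `^ p * (diam S g)%:R ^+ n) `^ p^-1.

Section Norm.
Variables (p : R) (p_ge1 : 1 <= p).

Lemma chain_norm_lpnorm n k (c : chain k) (D : {fset k.-tuple G}) :
  (msupp c `<=` D)%fset ->
  chain_norm p n c =
    lpnorm D (fun g => (diam S g)%:R ^+ n) p (fun g => normc c@_g).
Proof.
move=> cD; congr (_ `^ _); apply: big_fset_incl => // g _ gc.
by rewrite mcoeff_outdom// normc0 powR0 ?mul0r// gt_eqF// (lt_le_trans ltr01).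
Qed.

Lemma chain_normD n k (c d : chain k) :
  chain_norm p n (c + d) <= chain_norm p n c + chain_norm p n d.
Proof.
pose D := (msupp c `|` msupp d)%fset.
rewrite !(@chain_norm_lpnorm _ _ _ D) ?fsubsetUl ?fsubsetUr ?msuppD_le//.
have w0 (g : k.-tuple G) : 0 <= (diam S g)%:R ^+ n :> R by rewrite exprn_ge0.
apply: (@le_trans _ _ (lpnorm D (fun g => (diam S g)%:R ^+ n) p
    (fun g => normc c@_g + normc d@_g))).
  by apply: lpnorm_mono => // g; rewrite normc_ge0 mcoeffD le_normcD.
by apply: lpnormD => // g; apply: normc_ge0.
Qed.

Lemma chain_normZ n k a (c : chain k) :
  chain_norm p n (a *: c) = normc a * chain_norm p n c.
Proof.
rewrite !(@chain_norm_lpnorm _ _ _ (msupp c)) ?msuppZ_le//.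
have w0 (g : k.-tuple G) : 0 <= (diam S g)%:R ^+ n :> R by rewrite exprn_ge0.
rewrite -(lpnormZ _ w0 p_ge1 (normc_ge0 a) (fun g => normc_ge0 c@_g)).
by congr (lpnorm _ _ _ _); apply/funext => g; rewrite mcoeffZ normcM.
Qed.

Definition graph_norm k (n : nat) (c : chain k) : R :=
  chain_norm p n c + chain_norm p n (boundary R G k c).

Fact graph_normD k n (c d : chain k) :
  graph_norm n (c + d) <= graph_norm n c + graph_norm n d.
Proof. by rewrite /graph_norm linearD addrACA lerD ?chain_normD. Qed.

Fact graph_normZ k n a (c : chain k) :
  graph_norm n (a *: c) = normc a * graph_norm n c.
Proof. by rewrite /graph_norm linearZ_LR !chain_normZ mulrDr. Qed.

Definition graph_norms k := Seminorms (@graph_normD k) (@graph_normZ k).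

Lemma boundary_continuous k :
  continuous_for (graph_norms k) (graph_norms k.-1) (boundary R G k).
Proof.
move=> n; exists n, 1 => c; rewrite mul1r /= /graph_norm boundaryK.
have -> : chain_norm p n (0 : chain k.-1.-1) = 0.
  by rewrite -(scale0r 0) chain_normZ normc0 mul0r.
by rewrite addr0 lerDr powR_ge0.
Qed.

(* C_k^p(G) *)
Definition lp_chain k := completion (graph_norms k).
HB.instance Definition _ k := GRing.Lmodule.on (lp_chain k).

Definition lp_boundary k : {linear lp_chain k -> lp_chain k.-1} :=
  completion_map (@boundary_continuous k).

Lemma lp_boundaryK k (c : lp_chain k) : lp_boundary k.-1 (lp_boundary k c) = 0.
Proof.
rewrite -[c]subquo_reprK /lp_boundary /= /completion_map.
rewrite (subquo_map_pi _ _ (repr c)) (subquo_map_pi _ _ (submod_map _ _)).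
rewrite -(linear0 (subquo_pi _)); congr subquo_pi; apply/val_inj => /=.
by apply/funext => i; rewrite /seq_map /= boundaryK.
Qed.

(* H_k^p(G) *)
Definition lp_homology k := homology (lp_boundary k.+1) (lp_boundary k).
HB.instance Definition _ k := GRing.Lmodule.on (lp_homology k).

End Norm.

Section Canonical.
Variables (p q : R) (p_ge1 : 1 <= p) (q_ge1 : 1 <= q) (pq : p <= q).

Lemma chain_norm_exponent n k (c : chain k) : chain_norm q n c <= chain_norm p n c.
Proof.
apply: lpnorm_exponent => // g; rewrite ?exprn_ge0 ?normc_ge0//.
case: n => [|n]; first by right.
have [->|d0] := posnP (diam S g); first by left; rewrite expr0n.
by right; rewrite exprn_ege1// ler1n.
Qed.

Lemma id_continuous k :
  continuous_for (graph_norms p_ge1 k) (graph_norms q_ge1 k) idfun.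
Proof.
by move=> n; exists n, 1 => c; rewrite mul1r lerD ?chain_norm_exponent.
Qed.

(* The continuous extension C_k^p(G) -> C_k^q(G) of the identity. *)
Definition lp_inclusion k : {linear lp_chain p_ge1 k -> lp_chain q_ge1 k} :=
  completion_map (@id_continuous k).

Lemma lp_inclusion_boundary k c :
  lp_boundary q_ge1 k (lp_inclusion k c) = lp_inclusion k.-1 (lp_boundary p_ge1 k c).
Proof.
rewrite -[c]subquo_reprK /lp_boundary /lp_inclusion /= /completion_map.
rewrite !(subquo_map_pi _ _ (repr c)) !(subquo_map_pi _ _ (submod_map _ _)).
by congr subquo_pi; apply/val_inj.
Qed.

Fact lp_inclusion_ker k : {homo lp_inclusion k : c /
  c \in subspace_pred (ker (lp_boundary p_ge1 k)) >->
  c \in subspace_pred (ker (lp_boundary q_ge1 k))}.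
Proof.
move=> c /eqP c0; apply/eqP; apply: etrans (lp_inclusion_boundary c) _.
by rewrite c0; exact: linear0.
Qed.

Fact lp_inclusion_im k : {homo lp_inclusion k : c /
  c \in subspace_pred (im (lp_boundary p_ge1 k.+1)) >->
  c \in subspace_pred (im (lp_boundary q_ge1 k.+1))}.
Proof.
move=> c /asboolP[b ->]; apply/asboolP; exists (lp_inclusion k.+1 b).
by rewrite lp_inclusion_boundary.
Qed.

(* The map H_k^p(G) -> H_k^q(G) induced by lp_inclusion. *)
Definition lp_canonical k : {linear lp_homology p_ge1 k -> lp_homology q_ge1 k} :=
  subquo_map (@lp_inclusion_ker k) (@lp_inclusion_im k).

End Canonical.
End LpHomology.

(* Main.v *)
Require Import Defs.
From mathcomp Require Import all_boot all_order all_algebra finmap.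
From mathcomp Require Import boolp classical_sets reals.
From HB Require Import structures.
From mathcomp Require Import functions cardinality exp complex monalg.
From mathcomp Require Import zify ring.

Set Implicit Arguments.
Unset Strict Implicit.
Unset Printing Implicit Defensive.

Import Order.TTheory GRing.Theory Num.Theory.
Import Normc.
Local Open Scope ring_scope.

(** The inverse of the canonical map comes from a chain homotopy on the bar
    complex itself.  Write [d] for the boundary and suppose that linear maps
    [A k] from [k]-chains to [k.+1]-chains are such that both [A] and [id - dA]
    are bounded from the weighted l^q-norms to the weighted l^p-norms
    ([smoothing_exists], [tame_dominated]).  The chain map
    [smoothing = id - dA - Ad] is then bounded from the graph norms for [q] to
    the graph norms for [p]: it equals [(id - dA) - Ad], and its boundary is
    [(id - dA) d].  As the l^q-norm is at most the l^p-norm, [A] is also bounded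
    for the graph norms of either exponent, because [dA = id - (id - dA)].
    Hence [smoothing] is a homotopy inverse of the inclusion of the completed
    complexes ([lp_canonical_bijective]).

    Passing from [q] to the smaller [p] costs nothing when the images of the
    simplices decay fast.  An operator [F] is called [tame] when the l^p-norm of
    [F << g >>], multiplied by the bound [growth (diam g) ^ k] for the number of
    simplices of the same diameter, grows polynomially in the diameter.  The
    weighted l^q-norms make the coefficients of a chain decay faster than any
    power of the diameter, so the triangle inequality alone bounds [F].

    For polynomial growth the identity is tame, and [A = 0] will do.  For
    exponential growth, [A] sends a simplex of diameter [r] to the average of
    its cones with apex in the ball of radius [N r]: this is a sum of
    [growth (N r)] distinct simplices with equal coefficients, of l^p-norm about
    [growth (N r) ^ (1/p - 1)].  Since [p > 1], a large [N] makes this smaller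
    than any prescribed exponential.  The boundary of such a cone is the simplex
    itself minus averaged cones over its faces, with the radius chosen for the
    simplex and not for the faces; so [id - dA] is small as well. *)

(** * Word length and balls *)

Section WordMetric.
Variables (G : groupType) (S : {fset G}) (S_gen : generates S).
Local Notation len := (word_length S).
Local Notation dist := (word_dist S).

Lemma word_length_word g : is_word S (len g) g.
Proof.
rewrite /word_length; case: pselect => [ex|[]].
  by case: ex_minnP => m /asboolP.
by have [n gn] := S_gen g; exists n; apply/asboolP.
Qed.

Lemma word_length_le n g : is_word S n g -> (len g <= n)%N.
Proof.
move=> gn; rewrite /word_length; case: pselect => // ex.
by case: ex_minnP => m _; apply; apply/asboolP.
Qed.

Lemma word_lengthM x y : (len (x * y)%g <= len x + len y)%N.
Proof.
have [s [<- sS {1}->]] := word_length_word x.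
have [t [<- tS {1}->]] := word_length_word y.
apply: word_length_le; exists (s ++ t); split.
- by rewrite size_cat.
- by rewrite all_cat sS.
- by rewrite big_cat.
Qed.

Lemma word_lengthV_le x : (len x^-1%g <= len x)%N.
Proof.
have [s [<- sS {1}->]] := word_length_word x.
apply: word_length_le; exists (rev (map (fun z => z^-1)%g s)); split.
- by rewrite size_rev size_map.
- rewrite all_rev all_map; apply: sub_all sS => z /=.
  by rewrite invgK orbC.
- elim: s {sS} => [|z s IH] /=; first by rewrite !big_nil invg1.
  by rewrite big_cons rev_cons -cats1 big_cat big_seq1 invgM IH.
Qed.

Lemma word_lengthV x : len x^-1%g = len x.
Proof.
by apply/eqP; rewrite eqn_leq word_lengthV_le -{1}[x]invgK word_lengthV_le.
Qed.

Lemma word_length1 : len 1%g = 0%N.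
Proof.
by apply/eqP; rewrite -leqn0; apply: word_length_le; exists [::]; rewrite big_nil.
Qed.

Lemma word_length0 x : len x = 0%N -> x = 1%g.
Proof.
move=> x0; have [s [ss _ ->]] := word_length_word x.
by move: ss; rewrite x0 => /size0nil->; rewrite big_nil.
Qed.

Lemma word_distC x y : dist x y = dist y x.
Proof. by rewrite /word_dist -word_lengthV invgM invgK. Qed.

Lemma word_dist_triangle y x z : (dist x z <= dist x y + dist y z)%N.
Proof.
apply: leq_trans (word_lengthM _ _).
by rewrite /word_dist -mulgA mulVKg.
Qed.

Lemma word_distxx x : dist x x = 0%N.
Proof. by rewrite /word_dist mulVg word_length1. Qed.

Lemma word_distM g x y : dist (g * x)%g (g * y)%g = dist x y.
Proof. by rewrite /word_dist invgM -mulgA mulKg. Qed.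

Lemma word_dist1 x : dist 1%g x = len x.
Proof. by rewrite /word_dist invg1 mul1g. Qed.

Definition ball (r : nat) : {fset G} :=
  fset_set [set g | (dist 1%g g <= r)%N].

(** The letter 1 pads short words, so that [products r] contains the whole ball
    of radius [r] and not only the sphere. *)
Definition letters : seq G := 1%g :: S ++ [seq x^-1%g | x <- S].

Fixpoint products (r : nat) : seq G :=
  if r is r'.+1 then [seq (x * y)%g | x <- letters, y <- products r']
  else [:: 1%g].

Lemma mem_products r x y :
  x \in letters -> y \in products r -> (x * y)%g \in products r.+1.
Proof. exact: allpairs_f. Qed.

Lemma products_len r g : (len g <= r)%N -> g \in products r.
Proof.
elim: r g => [|r IH] g gr.
  by rewrite (word_length0 (x := g)) ?inE//; apply/eqP; rewrite -leqn0.
have := word_length_word g; case: (len g) gr => [|n] nr [s [ss sS gE]].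
  move: ss sS gE => /size0nil-> _ ->; rewrite big_nil.
  by rewrite -[1%g]mulg1; apply: mem_products; rewrite ?mem_head ?IH ?word_length1.
case: s ss sS gE => // z s [ss] /= /andP[zS sS] ->; rewrite big_cons.
apply: mem_products.
  rewrite inE mem_cat; case/orP: zS => [->|zS]; first by rewrite orbT.
  by rewrite -[z]invgK map_f ?orbT.
apply: IH; apply: leq_trans (nr : n <= r)%N; apply: word_length_le.
by exists s; case: ss.
Qed.

(** [growth] counts through [fset_set], which is empty on infinite sets; the
    finiteness of balls makes it the true count. *)
Lemma finite_ball r : finite_set [set g | (dist 1%g g <= r)%N].
Proof.
apply: (@sub_finite_set _ _ [set` products r]) => [g /=|]; last exact: finite_seq.
by rewrite word_dist1; exact: products_len.
Qed.

Lemma in_ball r g : (g \in ball r) = (len g <= r)%N.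
Proof.
rewrite -word_dist1 in_fset_set; last exact: finite_ball.
by apply/idP/idP; rewrite inE.
Qed.

Lemma card_ball r : #|` ball r| = growth S r.
Proof. by []. Qed.

Lemma growth_gt0 r : (0 < growth S r)%N.
Proof.
rewrite -card_ball cardfs_gt0; apply/fset0Pn; exists 1%g.
by rewrite in_ball word_length1.
Qed.

Lemma growth0 : growth S 0 = 1%N.
Proof.
rewrite -card_ball; suff -> : ball 0 = [fset 1%g]%fset by rewrite cardfs1.
apply/fsetP => g; rewrite in_ball inE; apply/idP/eqP => [|->].
  by rewrite leqn0 => /eqP/word_length0.
by rewrite word_length1.
Qed.

Lemma size_products r : size (products r) = (size letters ^ r)%N.
Proof. by elim: r => // r IH; rewrite [LHS]size_allpairs IH expnS. Qed.

Lemma growth_le_exp r : (growth S r <= size letters ^ r)%N.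
Proof.
rewrite -size_products -card_ball; apply: uniq_leq_size => [|g].
  exact: fset_uniq.
by rewrite in_ball; exact: products_len.
Qed.

End WordMetric.

(** * Counting simplices by diameter *)

Section Counting.
Variables (R : realType) (G : groupType) (S : {fset G}) (S_gen : generates S).
Local Notation dist := (word_dist S).

Lemma diam_le k (g : k.-tuple G) d :
  (forall i j, (dist (vertex g i) (vertex g j) <= d)%N) -> (diam S g <= d)%N.
Proof.
move=> gd; rewrite /diam; apply/bigmax_leqP_seq.
move=> x /(@tnthP _ _ [tuple of 1%g :: g])[i ->] _.
apply/bigmax_leqP_seq => y /(@tnthP _ _ [tuple of 1%g :: g])[j ->] _.
exact: gd.
Qed.

Lemma dist_vertex k (g : k.-tuple G) i j :
  (dist (vertex g i) (vertex g j) <= diam S g)%N.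
Proof.
have vg l : vertex g l \in (1%g :: g) by exact: mem_tnth.
apply: leq_trans (leq_bigmax_seq _ (vg i) isT).
exact: (@leq_bigmax_seq _ (1%g :: g) xpredT (dist (vertex g i))).
Qed.

Lemma diam_bracket_le k (x : 'I_k.+1 -> G) d :
  (forall i j, (dist (x i) (x j) <= d)%N) -> (diam S (bracket x) <= d)%N.
Proof.
by move=> xd; apply: diam_le => i j; rewrite !vertex_bracket word_distM.
Qed.

(** The first vertex of a bar symbol is 1, so the [k] others lie in the ball of
    radius [r]. *)
Lemma size_diam_le k (s : seq (k.-tuple G)) r : uniq s ->
  (forall g, g \in s -> (diam S g <= r)%N) -> (size s <= growth S r ^ k)%N.
Proof.
move=> s_uniq sr; have ball1 : 1%g \in ball S r by rewrite in_ball// word_length1.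
pose B : finType := ball S r; pose one : B := FSetSub ball1.
have <- : size [seq map_tuple (val : B -> G) t | t <- enum {: k.-tuple B}] =
    (growth S r ^ k)%N.
  by rewrite size_map -cardE card_tuple -cardfE.
apply: uniq_leq_size => // g gs.
apply/mapP; exists (map_tuple (insubd one) g); first by rewrite mem_enum.
apply: eq_from_tnth => i; rewrite !tnth_map insubdK//.
suff : tnth g i \in ball S r by [].
rewrite in_ball//; apply: leq_trans (sr g gs); rewrite -word_dist1.
have -> : 1%g = vertex g ord0 by [].
have -> : tnth g i = vertex g (lift ord0 i) by rewrite /vertex tnthS.
exact: dist_vertex.
Qed.

Lemma sum_inv_sqr_le n : \sum_(r < n) (r.+1%:R ^+ 2)^-1 <= 2 :> R.
Proof.
case: n => [|n]; first by rewrite big_ord0.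
(* this sharper bound telescopes *)
suff : \sum_(r < n.+1) (r.+1%:R ^+ 2)^-1 <= 2 - n.+1%:R^-1 :> R.
  by move=> /le_trans; apply; rewrite gerBl invr_ge0.
elim: n => [|n IH].
  by rewrite big_ord1 expr1n invr1 lerBrDr.
rewrite big_ord_recr /=; apply: le_trans (lerD IH (lexx _)) _.
rewrite -addrA lerD2l -lerBrDl opprK addrC.
set a : R := n.+1%:R; have -> : n.+2%:R = a + 1 by rewrite -natr1.
have a0 : 0 < a by rewrite ltr0Sn.
clearbody a.
have -> : a^-1 - (a + 1)^-1 = (a * (a + 1))^-1.
  by field; rewrite !gt_eqF ?addr_gt0.
rewrite lef_pV2 ?posrE ?mulr_gt0 ?exprn_gt0 ?addr_gt0//.
by rewrite expr2 ler_wpM2r ?lerDl// ltW// addr_gt0.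
Qed.

(** The simplices of a given diameter [r] contribute at most [1 / (r + 1) ^ 2]
    together. *)
Lemma sum_inv_growth_le k (D : {fset k.-tuple G}) :
  \sum_(g <- D)
    ((growth S (diam S g))%:R ^+ k * (diam S g).+1%:R ^+ 2)^-1 <= 2 :> R.
Proof.
pose X := (\max_(g <- D) diam S g).+1.
have DX g : g \in D -> (diam S g < X)%N by move=> gD; apply: leq_bigmax_seq.
apply: le_trans (sum_inv_sqr_le X).
pose f r : R := ((growth S r)%:R ^+ k * r.+1%:R ^+ 2)^-1.
have -> : \sum_(g <- D) f (diam S g) =
    \sum_(r < X) \sum_(g <- D | diam S g == r) f r.
  under [RHS]eq_bigr do rewrite big_mkcond.
  rewrite exchange_big /= !big_seq; apply: eq_bigr => g /DX gX.
  rewrite (bigD1 (Ordinal gX)) //= eqxx big1 ?addr0// => r rg.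
  by rewrite ifN//; apply: contra rg => /eqP gr; apply/eqP/val_inj.
apply: ler_sum => r _; rewrite big_const_seq iter_addr_0.
have gr0 : 0 < (growth S r)%:R :> R by rewrite ltr0n growth_gt0.
rewrite /f invfM -[leLHS]mulr_natl mulrA ler_piMl ?invr_ge0 ?exprn_ge0//.
rewrite ler_pdivrMr ?exprn_gt0// mul1r -natrX ler_nat -size_filter.
apply: size_diam_le => [|g]; first exact/filter_uniq/fset_uniq.
by rewrite mem_filter => /andP[/eqP->].
Qed.

End Counting.

(** * Bounded operators on weighted chains *)

(** Finite sums of seminorms, rather than a single seminorm as in
    [continuous_for], because the weight of positive order kills the simplex
    of diameter 0, which is only seen by the seminorm of order 0. *)
Definition dominated (R : realType) (V W : Type) (N : nat -> V -> R)
    (N' : nat -> W -> R) (f : V -> W) : Prop :=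
  forall n, exists m C, 0 <= C /\ forall v, N' n (f v) <= C * \sum_(i < m) N i v.

Lemma powR_cancel_le (R : realType) (q x y : R) :
  0 < q -> 0 <= x -> 0 <= y -> x `^ q <= y `^ q -> x <= y.
Proof.
move=> q0 x0 y0; apply: contraTT; rewrite -!ltNge => yx.
exact: gt0_ltr_powR.
Qed.

Section Operators.
Variables (R : realType) (G : groupType) (S : {fset G}) (S_gen : generates S).
Local Notation chain := (chain R G).
Local Notation cnorm := (chain_norm S).

Lemma chain_norm_ge0 p n k (c : chain k) : 0 <= cnorm p n c.
Proof. exact: powR_ge0. Qed.

Lemma chain_norm0 p n k : 1 <= p -> cnorm p n (0 : chain k) = 0.
Proof. by move=> p1; rewrite -(scale0r 0) chain_normZ// normc0 mul0r. Qed.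

Lemma chain_normN p n k (c : chain k) : 1 <= p -> cnorm p n (- c) = cnorm p n c.
Proof. by move=> p1; rewrite -scaleN1r chain_normZ// normcN normc1 mul1r. Qed.

Lemma chain_norm_sum p n k (I : Type) (s : seq I) (c : I -> chain k) :
  1 <= p -> cnorm p n (\sum_(i <- s) c i) <= \sum_(i <- s) cnorm p n (c i).
Proof.
move=> p1; elim: s => [|i s IH]; first by rewrite !big_nil chain_norm0.
by rewrite !big_cons; apply: le_trans (chain_normD _ p1 _ _ _) _; rewrite lerD.
Qed.

Lemma chain_decomp k (c : chain k) :
  c = \sum_(g <- msupp c) c@_g *: (<< g >> : chain k).
Proof.
rewrite {1}[c]monalgE; apply: eq_bigr => g _; apply/malgP => h.
by rewrite mcoeffZ !mcoeffU mulr_natr.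
Qed.

Lemma coef_powR_le q n k (c : chain k) g : 1 <= q ->
  normc c@_g `^ q * (diam S g)%:R ^+ n <= cnorm q n c `^ q.
Proof.
move=> q1; have q0 : 0 < q by exact: lt_le_trans q1.
have w0 (h : k.-tuple G) : 0 <= (diam S h)%:R ^+ n :> R by rewrite exprn_ge0.
rewrite /chain_norm lpnormK//; have [gc|gc] := boolP (g \in msupp c).
  rewrite (big_rem g)//= lerDl sumr_ge0// => h _.
  by rewrite mulr_ge0 ?powR_ge0.
rewrite mcoeff_outdom// normc0 powR0 ?gt_eqF// mul0r sumr_ge0// => h _.
by rewrite mulr_ge0 ?powR_ge0.
Qed.

(** One coefficient is bounded by the whole l^q-sum.  The weight [diam ^ (N * j)]
    with [q <= N] survives the [q]-th root as a weight at least [diam ^ j]; in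
    diameter 0 the norm of order 0 is used instead, where the weight is 1. *)
Lemma coef_weight_le q j k : 1 <= q -> exists m, forall (c : chain k) g,
  normc c@_g * (diam S g).+1%:R ^+ j <= 2 ^+ j * \sum_(i < m) cnorm q i c.
Proof.
move=> q1; have q0 : 0 < q by exact: lt_le_trans q1.
have [N qN] : exists N : nat, q <= N%:R.
  by exists (Num.bound q); rewrite ltW ?archi_boundP ?ltW.
exists (N * j).+1 => c g; set d := diam S g; set a := normc _.
have a0 : 0 <= a by exact: normc_ge0.
have le_sum i x : (i < (N * j).+1)%N -> x `^ q <= cnorm q i c `^ q -> 0 <= x ->
    x <= \sum_(i < (N * j).+1) cnorm q i c.
  move=> iN xc x0; apply: (@le_trans _ _ (cnorm q i c)).
    exact: powR_cancel_le q0 x0 (chain_norm_ge0 _ _ _) xc.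
  rewrite (bigD1 (Ordinal iN)) //= lerDl sumr_ge0// => l _.
  exact: chain_norm_ge0.
have [d0|d0] := posnP d.
  rewrite d0 expr1n mulr1; apply: (@le_trans _ _ (\sum_(i < (N * j).+1) cnorm q i c)).
    apply: (le_sum 0%N) => //; apply: le_trans (coef_powR_le 0 c g q1).
    by rewrite expr0 mulr1.
  rewrite ler_peMl ?exprn_ege1 ?ler1n// sumr_ge0// => l _.
  exact: chain_norm_ge0.
have dd : d.+1%:R ^+ j <= 2 ^+ j * d%:R ^+ j :> R.
  rewrite -exprMn -natrM lerXn2r ?nnegrE ?ler0n// ler_nat.
  by rewrite mul2n -addnn -addn1 leq_add2l.
apply: (le_trans (ler_wpM2l a0 dd)); rewrite mulrCA ler_wpM2l ?exprn_ge0//.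
apply: (le_sum (N * j)%N) => //; last by rewrite mulr_ge0 ?exprn_ge0.
apply: le_trans (coef_powR_le _ c g q1).
rewrite powRM ?exprn_ge0// ler_wpM2l ?powR_ge0//.
apply: (@le_trans _ _ ((d%:R ^+ j) `^ N%:R)).
  by rewrite ler_powR ?exprn_ege1 ?ler1n.
by rewrite powR_mulrn ?exprn_ge0// -exprM mulnC.
Qed.

(** The factor [growth (diam g) ^ k] bounds the number of [k]-simplices of the
    same diameter as [g]. *)
Definition tame (p : R) k l (F : chain k -> chain l) : Prop :=
  forall n, exists (M : R) j, forall g : k.-tuple G,
    (growth S (diam S g))%:R ^+ k * cnorm p n (F << g >>) <=
      M * (diam S g).+1%:R ^+ j.

(** Each coefficient is bounded by a seminorm times [(1 + diam) ^ - (j + 2)]: the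
    power [j] compensates the growth allowed by tameness, and the remaining
    square makes the sum over all simplices converge.  The l^q-norm is only used
    to bound single coefficients, whence the freedom in the exponents. *)
Lemma tame_dominated p q k l (F : {linear chain k -> chain l}) :
  1 <= p -> 1 <= q -> tame p F ->
  dominated (fun n => cnorm q n (k:=k)) (fun n => cnorm p n (k:=l)) F.
Proof.
move=> p1 q1 tF n; have [M [j FM]] := tF n.
have [m cm] := coef_weight_le j.+2 k q1.
exists m, (2 * `|M| * 2 ^+ j.+2); split=> [|c].
  by rewrite mulr_ge0 ?exprn_ge0 ?mulr_ge0.
set N := \sum_(i < m) _; have N0 : 0 <= N.
  by rewrite sumr_ge0// => i _; exact: chain_norm_ge0.
rewrite {1}[c]chain_decomp linear_sum; apply: le_trans (chain_norm_sum _ _ _ p1) _.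
pose w (g : k.-tuple G) : R :=
  ((growth S (diam S g))%:R ^+ k * (diam S g).+1%:R ^+ 2)^-1.
apply: (@le_trans _ _ (\sum_(g <- msupp c) `|M| * 2 ^+ j.+2 * N * w g)); last first.
  rewrite -mulr_sumr [leRHS](_ : _ = `|M| * 2 ^+ j.+2 * N * 2); last by ring.
  apply: ler_wpM2l; last exact: sum_inv_growth_le.
  by apply: mulr_ge0 => //; rewrite mulr_ge0 ?exprn_ge0.
apply: ler_sum => g _; rewrite linearZ_LR chain_normZ//.
set d := diam S g; have b0 : 0 < (growth S d)%:R ^+ k :> R.
  by rewrite exprn_gt0 ?ltr0n ?growth_gt0.
have d0 : 0 < d.+1%:R :> R by rewrite ltr0Sn.
rewrite /w -/d ler_pdivlMr; last by rewrite mulr_gt0// exprn_gt0.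
have := FM g; rewrite -/d => Fg; have := cm c g; rewrite -/d -/N => cg.
have Fg' := le_trans Fg (ler_wpM2r (exprn_ge0 j (ltW d0)) (ler_norm M)).
rewrite -(ler_pM2r (exprn_gt0 j d0)).
set b := (growth S d)%:R ^+ k in b0 Fg' *; set x := cnorm p n _ in Fg' *.
set a := normc _ in cg *; have a0 : 0 <= a by exact: normc_ge0.
have -> : a * x * (b * d.+1%:R ^+ 2) * d.+1%:R ^+ j =
  (a * d.+1%:R ^+ j.+2) * (b * x) by rewrite !exprSr expr0; ring.
have -> : `|M| * 2 ^+ j.+2 * N * d.+1%:R ^+ j = 2 ^+ j.+2 * N * (`|M| * d.+1%:R ^+ j).
  by ring.
apply: ler_pM => //; apply: mulr_ge0 => //.
- exact/exprn_ge0/ltW.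
- exact: ltW.
- exact: chain_norm_ge0.
Qed.

End Operators.

(** * Averaged cones *)

Section Cones.
Variables (R : realType) (G : groupType) (S : {fset G}) (S_gen : generates S).
Local Notation chain := (chain R G).
Local Notation cnorm := (chain_norm S).
Local Notation dist := (word_dist S).

Definition cone k (h : G) (x : 'I_k.+1 -> G) : 'I_k.+2 -> G :=
  fun i => if unlift ord0 i is Some j then x j else h.

Lemma cone0 k h (x : 'I_k.+1 -> G) : cone h x ord0 = h.
Proof. by rewrite /cone unlift_none. Qed.

Lemma coneS k h (x : 'I_k.+1 -> G) i : cone h x (lift ord0 i) = x i.
Proof. by rewrite /cone liftK. Qed.

Lemma cone_face0 k h (x : 'I_k.+1 -> G) : cone h x \o lift ord0 = x.
Proof. by apply/funext => i /=; rewrite coneS. Qed.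

Lemma cone_faceS k h (x : 'I_k.+2 -> G) i :
  cone h x \o lift (lift ord0 i) = cone h (x \o lift i).
Proof.
apply/funext => j /=; case: (unliftP ord0 j) => [l ->|->].
  have -> : lift (lift ord0 i) (lift ord0 l) = lift ord0 (lift i l).
    by apply/val_inj; rewrite /= /bump; lia.
  by rewrite !coneS.
have -> : lift (lift ord0 i) ord0 = ord0 by apply/val_inj.
by rewrite !cone0.
Qed.

(** The apex can be read off from the first entry [h^-1 * x ord0] of the bar
    symbol, so translating simplices to the base point 1 does not identify
    different cones over [x]. *)
Lemma bracket_cone_inj k (x : 'I_k.+1 -> G) : injective (fun h => bracket (cone h x)).
Proof.
move=> h h' /(congr1 (fun t => tnth t ord0)); rewrite !tnth_mktuple.
by rewrite !cone0 !coneS => /mulIg/invg_inj.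
Qed.

Lemma symbol_vertex k (g : k.-tuple G) : symbol R (vertex g) = << g >>.
Proof.
congr (<< _ >>); apply: eq_from_tnth => i; rewrite tnth_mktuple.
by rewrite /vertex tnth0 tnthS invg1 mul1g.
Qed.

(** The ball of apexes is centred at 1, the first vertex of the bar symbols to
    which this is applied.  The averaged simplices are pairwise distinct, which
    makes the l^p-norm small for [1 < p]. *)
Definition avg_cone k (r : nat) (x : 'I_k.+1 -> G) : chain k.+1 :=
  real_complex R (growth S r)%:R^-1 *: \sum_(h <- ball S r) symbol R (cone h x).

Lemma avg_growth r (V : lmodType R[i]) (v : V) :
  real_complex R (growth S r)%:R^-1 *: \sum_(h <- ball S r) v = v.
Proof.
rewrite big_const_seq count_predT iter_addr_0 -scaler_nat scalerA.
rewrite -[X in X%:R]/(growth S r) -(rmorph_nat (real_complex R)) -rmorphM /=.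
by rewrite mulVf ?scale1r// pnatr_eq0 -lt0n growth_gt0.
Qed.

(** The face opposite to the apex is [x] for every apex, and the other faces are
    cones over the faces of [x], still averaged over radius [r]. *)
Lemma boundary_avg_cone k r (x : 'I_k.+2 -> G) :
  boundary R G k.+2 (avg_cone r x) =
  symbol R x - \sum_(i < k.+2) (-1) ^+ i *: avg_cone r (x \o lift i).
Proof.
transitivity (real_complex R (growth S r)%:R^-1 *:
    \sum_(h <- ball S r) simplex_boundary R (cone h x)).
  apply: etrans (linearZ_LR _ _ _) _; congr (_ *: _).
  rewrite (linear_sum (boundary R G k.+2)); apply: eq_bigr => h _.
  exact: boundary_symbol.
rewrite /simplex_boundary; under eq_bigr => h _.
  rewrite big_ord_recl expr0 scale1r cone_face0.
  under eq_bigr => i _ do rewrite cone_faceS exprS mulN1r scaleNr.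
  over.
rewrite big_split /= scalerDr avg_growth; congr (_ + _).
rewrite exchange_big /= scaler_sumr -sumrN; apply: eq_bigr => i _.
by rewrite sumrN scalerN -scaler_sumr scalerA mulrC -scalerA.
Qed.

Lemma diam_cone_le k r d (x : 'I_k.+1 -> G) h :
  (forall i, (dist 1 (x i) <= d)%N) ->
  (forall i j, (dist (x i) (x j) <= d)%N) ->
  h \in ball S r -> (diam S (bracket (cone h x)) <= r + d)%N.
Proof.
move=> x1 xx; rewrite in_ball// -word_dist1 => hr.
have hx i : (dist h (x i) <= r + d)%N.
  apply: leq_trans (word_dist_triangle S_gen 1%g h (x i)) _.
  by rewrite leq_add// word_distC.
apply: diam_bracket_le => i j.
case: (unliftP ord0 i) => [i' ->|->]; case: (unliftP ord0 j) => [j' ->|->].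
- by rewrite !coneS; apply: leq_trans (xx _ _) (leq_addl _ _).
- by rewrite cone0 coneS word_distC.
- by rewrite cone0 coneS.
- by rewrite !cone0 word_distxx.
Qed.

(** A sum of [b] distinct simplices with coefficients [1 / b] has l^p-norm
    [b ^ (1/p - 1)], up to the weights. *)
Lemma avg_cone_norm_le p n k r d (x : 'I_k.+1 -> G) : 1 <= p ->
  (forall i, (dist 1 (x i) <= d)%N) ->
  (forall i j, (dist (x i) (x j) <= d)%N) ->
  cnorm p n (avg_cone r x) <=
    (growth S r)%:R `^ (p^-1 - 1) * (r + d).+1%:R ^+ n.
Proof.
move=> p1 x1 xx; have p0 : 0 < p by exact: lt_le_trans p1.
set b : R := (growth S r)%:R; have b0 : 0 < b by rewrite ltr0n growth_gt0.
set W : R := (r + d).+1%:R ^+ n; have W1 : 1 <= W by rewrite exprn_ege1// ler1n.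
pose D := [fset bracket (cone h x) | h in ball S r]%fset.
have coef h : h \in ball S r ->
    (avg_cone r x)@_(bracket (cone h x)) = real_complex R b^-1.
  move=> hr; rewrite mcoeffZ raddf_sum /= (big_fsetD1 h)//= mcoeffUU big1_seq.
    by rewrite addr0 mulr1.
  move=> h' /andP[_]; rewrite !inE => /andP[hh' _]; rewrite mcoeffU.
  by case: eqP => // /bracket_cone_inj hh; rewrite hh eqxx in hh'.
have suppD : (msupp (avg_cone r x) `<=` D)%fset.
  apply: fsubset_trans (msuppZ_le _ _) _; apply/fsubsetP => g.
  apply: contraLR => gD; rewrite -mcoeff_eq0 raddf_sum /= big1_seq// => h /andP[_ hr].
  rewrite mcoeffU; case: eqP => // hg; rewrite -hg in gD.
  by case/negP: gD; apply/imfsetP; exists h.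
rewrite (chain_norm_lpnorm _ p1 _ suppD); apply: lpnorm_le => //.
- by move=> g; rewrite exprn_ge0.
- by rewrite mulr_ge0 ?powR_ge0// (le_trans ler01).
rewrite /D big_imfset /=; last by move=> h h' _ _; exact: bracket_cone_inj.
apply: (@le_trans _ _ (\sum_(h <- ball S r) b `^ (- p) * W)).
  rewrite big_seq [leRHS]big_seq; apply: ler_sum => h hr; rewrite coef//.
  have -> : normc (real_complex R b^-1) = b^-1.
    by rewrite /normc /= expr0n addr0 sqrtr_sqr ger0_norm// invr_ge0 ltW.
  apply: ler_pM; rewrite ?powR_ge0 ?exprn_ge0//.
    by rewrite -powR_inv1 ?(ltW b0)// -powRrM mulN1r.
  by rewrite lerXn2r ?nnegrE// ler_nat ltnW// ltnS diam_cone_le.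
rewrite big_const_seq count_predT iter_addr_0 -[size _]/(growth S r).
rewrite -mulr_natl -/b mulrA powRM ?powR_ge0 ?(le_trans ler01)//.
apply: ler_pM; rewrite ?mulr_ge0 ?powR_ge0 ?(ltW b0) ?(le_trans ler01)//.
  rewrite -{1}[b]powRr1 ?(ltW b0)// -powRD; last by rewrite (gt_eqF b0) implybT.
  by rewrite -powRrM mulrBl mulVf ?gt_eqF// mul1r.
rewrite -{1}[W]powRr1 ?(le_trans ler01)//.
by rewrite ler_powR.
Qed.

Definition linear_extension k l (f : k.-tuple G -> chain l) (c : chain k) :=
  \sum_(g <- msupp c) c@_g *: f g.

Section LinearExtension.
Variables (k l : nat) (f : k.-tuple G -> chain l).

Lemma linear_extensionEw (c : chain k) (D : {fset k.-tuple G}) :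
  (msupp c `<=` D)%fset -> linear_extension f c = \sum_(g <- D) c@_g *: f g.
Proof.
move=> cD; apply: big_fset_incl => // g _ gc.
by rewrite mcoeff_outdom// scale0r.
Qed.

Lemma linear_extension_linear : linear (linear_extension f).
Proof.
move=> a u v; pose D := (msupp u `|` msupp v `|` msupp (a *: u + v))%fset.
rewrite !(@linear_extensionEw _ D).
- rewrite scaler_sumr -big_split; apply: eq_bigr => g _ /=.
  by rewrite mcoeffD mcoeffZ scalerDl scalerA.
- by rewrite /D -fsetUA fsetUCA fsubsetUl.
- by rewrite /D -fsetUA fsubsetUl.
- by rewrite /D fsubsetUr.
Qed.
HB.instance Definition _ := GRing.isLinear.Build R[i] (chain k) (chain l)
  *:%R (linear_extension f) linear_extension_linear.

Lemma linear_extensionU g : linear_extension f << g >> = f g.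
Proof.
rewrite (@linear_extensionEw _ [fset g]%fset) ?msuppU_le//.
by rewrite big_seq_fset1 mcoeffUU scale1r.
Qed.

End LinearExtension.

End Cones.

(** * Tame operators from the growth hypothesis *)

Section Smoothing.
Variables (R : realType) (G : groupType) (S : {fset G}) (S_gen : generates S).
Local Notation chain := (chain R G).
Local Notation cnorm := (chain_norm S).
Local Notation dist := (word_dist S).
Local Notation tame := (tame S).

(** In degree 0 there is only one simplex. *)
Lemma tame_degree0 p l (F : chain 0 -> chain l) : tame p F.
Proof.
move=> n; exists (cnorm p n (F << [tuple] >>)), 0%N => g.
by rewrite [g]tuple0 !expr0 mul1r mulr1.
Qed.

Lemma tame0 p k l : 1 <= p -> tame p (\0 : chain k -> chain l).
Proof.
by move=> p1 n; exists 0, 0%N => g; rewrite mul0r [X in _ * X]chain_norm0 ?mulr0.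
Qed.

Lemma norm_simplex_le p n k (g : k.-tuple G) : 1 <= p ->
  cnorm p n (<< g >> : chain k) <= (diam S g).+1%:R ^+ n.
Proof.
move=> p1; rewrite (@chain_norm_lpnorm _ _ _ _ p1 _ _ _ [fset g]%fset) ?msuppU_le//.
have p0 : 0 < p by exact: lt_le_trans p1.
apply: lpnorm_le => // [h||]; rewrite ?exprn_ge0//.
rewrite big_seq_fset1 mcoeffUU normc1 powR1 mul1r.
apply: (@le_trans _ _ ((diam S g).+1%:R ^+ n)).
  by rewrite lerXn2r ?nnegrE// ler_nat.
have W1 : 1 <= (diam S g).+1%:R ^+ n :> R by rewrite exprn_ege1// ler1n.
by rewrite -{1}[_ ^+ n]powRr1 ?(le_trans ler01)// ler_powR.
Qed.

(** Polynomial growth makes [growth (diam g) ^ k] itself a bound that tameness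
    allows. *)
Lemma tame_id_polynomial p k : 1 <= p -> polynomial_growth S R ->
  tame p (idfun : chain k -> chain k).
Proof.
move=> p1 [D [K [K0 growthK]]] n; exists ((K + 1) ^+ k), (D * k + n)%N => g.
set d := diam S g; have gK : (growth S d)%:R <= (K + 1) * d.+1%:R ^+ D.
  have [->|d0] := posnP d; first by rewrite growth0// expr1n mulr1 lerDr ltW.
  apply: le_trans (growthK _ d0) _; apply: ler_pM; rewrite ?exprn_ge0 ?(ltW K0) ?lerDl//.
  by rewrite lerXn2r ?nnegrE// ler_nat.
rewrite exprD mulrA exprM -exprMn; apply: ler_pM.
- by rewrite exprn_ge0.
- exact: chain_norm_ge0.
- by rewrite lerXn2r ?nnegrE// (le_trans _ gK).
- exact: norm_simplex_le.
Qed.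

Lemma bernoulli_le (x : R) n : 0 <= x -> 1 + n%:R * x <= (1 + x) ^+ n.
Proof.
move=> x0; elim: n => [|n IH]; first by rewrite mul0r addr0 expr0.
have x1 : 0 <= 1 + x by rewrite addr_ge0.
rewrite exprS; apply: le_trans (ler_wpM2l x1 IH).
rewrite -natr1; have : 0 <= n%:R * x * x by rewrite !mulr_ge0.
by move=> H; rewrite -subr_ge0 [X in 0 <= X](_ : _ = n%:R * x * x)//; ring.
Qed.

(** If [L] is the number of letters, then [growth r <= L ^ r], whereas
    [growth (N * r) >= a ^ (N * r)] with [1 < a]; as [1 - 1/p > 0], any [N] with
    [L ^ k <= (a ^ (1 - 1/p)) ^ N] works. *)
Lemma exponential_radius p k : 1 < p -> exponential_growth S R ->
  exists N : nat, forall r,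
    (growth S r)%:R ^+ k * (growth S (N * r))%:R `^ (p^-1 - 1) <= 1 :> R.
Proof.
move=> p1 [a [a1 growtha]]; have p0 : 0 < p by exact: lt_trans p1.
have th0 : 0 < 1 - p^-1 by rewrite subr_gt0 invf_lt1.
set th := 1 - p^-1 in th0; have a0 : 0 < a by exact: lt_trans a1.
have b1 : 1 < a `^ th.
  suff : 1 `^ th < a `^ th by rewrite powR1.
  by apply: gt0_ltr_powR; rewrite ?nnegrE ?(ltW a0).
pose L : R := (size (letters S))%:R.
have [N LN] : exists N : nat, L ^+ k <= (a `^ th) ^+ N.
  have b0 : 0 < a `^ th - 1 by rewrite subr_gt0.
  have Lb : 0 <= L ^+ k / (a `^ th - 1) by rewrite divr_ge0 ?exprn_ge0// ltW.
  exists (Num.bound (L ^+ k / (a `^ th - 1))).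
  rewrite -[X in _ <= X ^+ _](subrK 1) [X in _ <= X ^+ _]addrC.
  apply: le_trans (bernoulli_le _ (ltW b0)).
  rewrite ler_wpDl// -ler_pdivrMr//; exact/ltW/archi_boundP.
exists N => r; rewrite -opprB powRN.
have gr : 0 < (growth S (N * r))%:R :> R by rewrite ltr0n growth_gt0.
rewrite ler_pdivrMr ?powR_gt0// mul1r.
apply: (@le_trans _ _ ((L ^+ k) ^+ r)).
  rewrite exprAC lerXn2r ?nnegrE ?exprn_ge0//.
  by rewrite /L -natrX ler_nat growth_le_exp.
apply: (@le_trans _ _ (((a `^ th) ^+ N) ^+ r)).
  by rewrite lerXn2r ?nnegrE ?exprn_ge0 ?powR_ge0.
rewrite -exprM -powR_mulrn ?powR_ge0// -powRrM mulrC powRrM powR_mulrn ?(ltW a0)//.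
by rewrite ge0_ler_powR ?nnegrE ?exprn_ge0 ?(ltW a0) ?(ltW th0).
Qed.

Definition cone_operator N k : chain k -> chain k.+1 :=
  linear_extension (fun g => avg_cone R S (N * diam S g) (vertex g)).
HB.instance Definition _ N k := GRing.Linear.on (@cone_operator N k).

Lemma vertex_dist1 k (g : k.-tuple G) i :
  (dist 1 (vertex g i) <= diam S g)%N.
Proof. exact: (dist_vertex S g ord0 i). Qed.

Lemma avg_cone_tame p N k (g : k.-tuple G) l (x : 'I_l.+1 -> G) n : 1 <= p ->
  (forall r, (growth S r)%:R ^+ k * (growth S (N * r))%:R `^ (p^-1 - 1) <= 1 :> R) ->
  (forall i, exists j, x i = vertex g j) ->
  (growth S (diam S g))%:R ^+ k * cnorm p n (avg_cone R S (N * diam S g) x) <=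
    N.+1%:R ^+ n * (diam S g).+1%:R ^+ n.
Proof.
move=> p1 hN xg; set d := diam S g.
have x1 i : (dist 1 (x i) <= d)%N by have [j ->] := xg i; exact: vertex_dist1.
have xx i j : (dist (x i) (x j) <= d)%N.
  by have [i' ->] := xg i; have [j' ->] := xg j; exact: dist_vertex.
have b0 : 0 <= (growth S d)%:R ^+ k :> R by rewrite exprn_ge0.
apply: le_trans (ler_wpM2l b0 (avg_cone_norm_le S_gen n (N * d) p1 x1 xx)) _.
rewrite mulrA -exprMn -[leRHS]mul1r.
apply: ler_pM; rewrite ?mulr_ge0 ?powR_ge0 ?exprn_ge0//.
by rewrite lerXn2r ?nnegrE ?mulr_ge0// -natrM ler_nat; nia.
Qed.

Lemma cone_operator_tame p N k : 1 <= p ->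
  (forall r, (growth S r)%:R ^+ k * (growth S (N * r))%:R `^ (p^-1 - 1) <= 1 :> R) ->
  tame p (@cone_operator N k).
Proof.
move=> p1 hN n; exists (N.+1%:R ^+ n), n => g.
rewrite [cone_operator N _]linear_extensionU.
by apply: avg_cone_tame => // i; exists i.
Qed.

(** Here the apex radius is adapted to the diameter of [g] although the cones are
    over the faces of [g], which may be much smaller: the remainder is as small
    as the cone operator itself.  A 0-simplex has no cones over its faces, so
    degree 0 is separate. *)
Lemma cone_remainder_tame p N k : 1 <= p ->
  (forall r, (growth S r)%:R ^+ k * (growth S (N * r))%:R `^ (p^-1 - 1) <= 1 :> R) ->
  tame p (fun c => c - boundary R G k.+1 (@cone_operator N k c)).
Proof.
case: k => [|k] p1 hN; first exact: tame_degree0.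
move=> n; exists (k.+2%:R * N.+1%:R ^+ n), n => g; set d := diam S g.
rewrite [cone_operator N _]linear_extensionU boundary_avg_cone//.
rewrite symbol_vertex opprB addrCA subrr addr0.
have b0 : 0 <= (growth S d)%:R ^+ k.+1 :> R by rewrite exprn_ge0.
apply: le_trans (ler_wpM2l b0 (chain_norm_sum _ _ _ _ p1)) _.
rewrite mulr_sumr -mulrA mulr_natl.
apply: (@le_trans _ _ (\sum_(i < k.+2) N.+1%:R ^+ n * d.+1%:R ^+ n)); last first.
  by rewrite sumr_const card_ord.
apply: ler_sum => i _; rewrite chain_normZ//.
have -> : normc ((-1) ^+ i : R[i]) = 1.
  elim: (i : nat) => [|m IH]; first by rewrite expr0 normc1.
  by rewrite exprS normcM IH normcN normc1 mulr1.
by rewrite mul1r; apply: avg_cone_tame => // j; exists (lift i j).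
Qed.

Lemma smoothing_exists p : 1 < p ->
  polynomial_growth S R \/ exponential_growth S R ->
  exists A : forall k, {linear chain k -> chain k.+1}, forall k,
    tame p (A k) /\ tame p (fun c => c - boundary R G k.+1 (A k c)).
Proof.
move=> p1 [poly|expo].
  exists (fun k => \0) => k; split; first exact/tame0/ltW.
  have -> : (fun c => c - boundary R G k.+1 ((\0 : {linear _ -> _}) c)) = idfun.
    by apply/funext => c; rewrite linear0 subr0.
  exact/tame_id_polynomial/poly/ltW.
have /choice[N hN] := fun k => exponential_radius k p1 expo.
exists (fun k => @cone_operator (N k) k) => k; split.
  by apply: cone_operator_tame => //; exact: ltW.
by apply: cone_remainder_tame => //; exact: ltW.
Qed.

End Smoothing.

(** * Dominated maps and completions *)

Section Dominated.
Variable R : realType.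

Lemma dominated_le (V W : Type) (N : nat -> V -> R) (N' : nat -> W -> R) f :
  (forall n v, 0 <= N n v) -> (forall n v, N' n (f v) <= N n v) ->
  dominated N N' f.
Proof.
move=> N0 fN n; exists n.+1, 1; split=> // v; rewrite mul1r.
apply: le_trans (fN n v) _.
by rewrite big_ord_recr /= lerDr sumr_ge0// => i _; exact: N0.
Qed.

Lemma dominated_add (V W W1 W2 : Type) (N : nat -> V -> R) (N' : nat -> W -> R)
    (N1 : nat -> W1 -> R) (N2 : nat -> W2 -> R) f g h :
  (forall n v, 0 <= N n v) ->
  (forall n v, N' n (f v) <= N1 n (g v) + N2 n (h v)) ->
  dominated N N1 g -> dominated N N2 h -> dominated N N' f.
Proof.
move=> N0 fgh dg dh n; have [m1 [C1 [C10 gC]]] := dg n.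
have [m2 [C2 [C20 hC]]] := dh n.
have sum_mono m m' v : (m <= m')%N -> \sum_(i < m) N i v <= \sum_(i < m') N i v.
  move=> mm; rewrite (big_ord_widen m' (fun i => N i v) mm).
  rewrite [leRHS](bigID (fun i : 'I_m' => (i < m)%N)) /=.
  by rewrite lerDl sumr_ge0// => i _; exact: N0.
exists (maxn m1 m2), (C1 + C2); split=> [|v]; first exact: addr_ge0.
apply: le_trans (fgh n v) _; rewrite mulrDl; apply: lerD.
  by apply: le_trans (gC v) _; rewrite ler_wpM2l// sum_mono// leq_maxl.
by apply: le_trans (hC v) _; rewrite ler_wpM2l// sum_mono// leq_maxr.
Qed.

Lemma dominated_comp_le (V V1 W : Type) (N : nat -> V -> R) (N1 : nat -> V1 -> R)
    (N' : nat -> W -> R) f s :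
  (forall n v, N1 n (s v) <= N n v) -> dominated N1 N' f ->
  dominated N N' (f \o s).
Proof.
move=> sN df n; have [m [C [C0 fC]]] := df n; exists m, C; split=> // v.
apply: le_trans (fC (s v)) _; rewrite ler_wpM2l//.
by apply: ler_sum => i _; exact: sN.
Qed.

Lemma dominated_le_comp (V W W' : Type) (N : nat -> V -> R) (N1 : nat -> W -> R)
    (N' : nat -> W' -> R) f s :
  (forall n w, N' n (s w) <= N1 n w) -> dominated N N1 f ->
  dominated N N' (s \o f).
Proof.
move=> sN df n; have [m [C [C0 fC]]] := df n; exists m, C; split=> // v.
exact: le_trans (sN n (f v)) (fC v).
Qed.

Section Completion.
Variables (V W : lmodType R[i]) (N : seminorms V) (N' : seminorms W).
Variable f : V -> W.
Hypothesis df : dominated N N' f.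

Lemma dominated_small n e : 0 < e -> exists m d, 0 < d /\
  forall v, (forall i, (i < m)%N -> N i v < d) -> N' n (f v) < e.
Proof.
move=> e0; have [m [C [C0 fC]]] := df n.
have Cm0 : 0 < C * m%:R + 1 by rewrite ltr_wpDl// mulr_ge0.
exists m, (e / (C * m%:R + 1)); split=> [|v vd]; first exact: divr_gt0.
apply: le_lt_trans (fC v) _.
apply: (@le_lt_trans _ _ (C * m%:R * (e / (C * m%:R + 1)))).
  rewrite -mulrA ler_wpM2l// mulr_natl -[m in _ *+ m]card_ord -sumr_const.
  by apply: ler_sum => i _; exact/ltW/vd.
by rewrite mulrCA gtr_pMr// ltr_pdivrMr// mul1r ltrDl.
Qed.

Lemma dominated_null u : u \in subspace_pred (null N) ->
  f \o u \in subspace_pred (null N').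
Proof.
rewrite !unfold_in => /asboolP u0; apply/asboolP => n e e0.
have [m [d [d0 fd]]] := dominated_small n e0.
have /choice[M uM] := fun i => u0 i d d0.
exists (\max_(i < m) M i) => j Mj; apply: fd => i im; apply: uM.
by apply: leq_trans Mj; exact: (leq_bigmax (Ordinal im)).
Qed.

Lemma dominated_cauchy u : {morph f : x y / x - y} ->
  u \in subspace_pred (cauchy N) -> f \o u \in subspace_pred (cauchy N').
Proof.
move=> fB; rewrite !unfold_in => /asboolP uC; apply/asboolP => n e e0.
have [m [d [d0 fd]]] := dominated_small n e0.
have /choice[M uM] := fun i => uC i d d0.
exists (\max_(i < m) M i) => j j' Mj Mj'; rewrite /= -fB.
by apply: fd => i im; apply: uM; [apply: leq_trans Mj|apply: leq_trans Mj'];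
   exact: (leq_bigmax (Ordinal im)).
Qed.

End Completion.

(** The element of the completion that a Cauchy sequence represents. *)
Definition limit_class (V : lmodType R[i]) (N : seminorms V) u
    (uC : u \in subspace_pred (cauchy N)) : completion N :=
  subquo_pi (null N) (Submod uC).

Lemma limit_classP (V : lmodType R[i]) (N : seminorms V) (x : completion N) :
  exists u (uC : u \in subspace_pred (cauchy N)), x = limit_class uC.
Proof.
exists (val (repr x)), (valP (repr x)); rewrite -[LHS]subquo_reprK.
by apply/subquo_piP; rewrite subrr; have [] := subspaceP (null N).
Qed.

Lemma limit_class_eq (V : lmodType R[i]) (N : seminorms V) u v
    (uC : u \in subspace_pred (cauchy N)) (vC : v \in subspace_pred (cauchy N)) :
  (limit_class uC = limit_class vC) <-> (u - v \in subspace_pred (null N)).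
Proof. exact: subquo_piP. Qed.

Lemma limit_class_eq0 (V : lmodType R[i]) (N : seminorms V) u
    (uC : u \in subspace_pred (cauchy N)) :
  (limit_class uC = 0) <-> (u \in subspace_pred (null N)).
Proof.
rewrite -[X in _ = X](linear0 (subquo_pi (null N))).
by split=> [/subquo_piP|u0]; [|apply/subquo_piP]; rewrite /= subr0.
Qed.

Lemma limit_classB (V : lmodType R[i]) (N : seminorms V) u v
    (uC : u \in subspace_pred (cauchy N)) (vC : v \in subspace_pred (cauchy N))
    (uvC : u - v \in subspace_pred (cauchy N)) :
  limit_class uC - limit_class vC = limit_class uvC.
Proof.
rewrite /limit_class -linearB; apply/subquo_piP; rewrite /= subrr.
by have [] := subspaceP (null N).
Qed.

Lemma completion_map_class (V W : lmodType R[i]) (N : seminorms V)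
    (N' : seminorms W) (f : {linear V -> W}) (fc : continuous_for N N' f) u
    (uC : u \in subspace_pred (cauchy N))
    (fuC : f \o u \in subspace_pred (cauchy N')) :
  completion_map fc (limit_class uC) = limit_class fuC.
Proof.
rewrite /completion_map subquo_map_pi; apply/subquo_piP.
by rewrite subrr; have [] := subspaceP (null N').
Qed.

End Dominated.

Lemma sub_sub3 (V : zmodType) (a b c d x y : V) :
  a - b - (c - d) - (x - y) = a - c - x - (b - d - y).
Proof. by rewrite !opprD !opprK (addrACA a) (addrACA (a - c)). Qed.

(** * The homotopy inverse *)

Section Homotopy.
Variables (R : realType) (G : groupType) (S : {fset G}).
Variables (p q : R) (p1 : 1 <= p) (q1 : 1 <= q) (pq : p <= q).
Local Notation chain := (chain R G).
Local Notation bd := (boundary R G).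
Local Notation cnorm := (chain_norm S).
Variable A : forall k, {linear chain k -> chain k.+1}.
Hypothesis A_dom : forall k, dominated (fun n => cnorm q n (k:=k))
  (fun n => cnorm p n (k:=k.+1)) (A k).
Hypothesis B_dom : forall k, dominated (fun n => cnorm q n (k:=k))
  (fun n => cnorm p n (k:=k)) (fun c => c - bd k.+1 (A k c)).

(** The term [A d] of the homotopy formula, which vanishes in degree 0. *)
Definition homotopy_tail k : {linear chain k -> chain k} :=
  match k with
  | 0 => \0
  | k'.+1 => A k' \o bd k'.+1
  end.

Definition smoothing k (c : chain k) : chain k :=
  c - bd k.+1 (A k c) - homotopy_tail k c.

Lemma smoothingB k : {morph @smoothing k : c d / c - d}.
Proof.
move=> c d; rewrite /smoothing (linearB (A k)) (linearB (bd k.+1)).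
by rewrite (linearB (homotopy_tail k)) sub_sub3.
Qed.

Lemma boundary_smoothing_eq k c :
  bd k (@smoothing k c) = bd k c - bd k.-1.+1 (A k.-1 (bd k c)).
Proof.
case: k c => [|k] c.
  rewrite -[LHS]/(0 : chain 0) -[bd 0 c]/(0 : chain 0) (linear0 (A 0)).
  by rewrite (linear0 (bd 1)) subr0.
rewrite /smoothing (linearB (bd k.+1)) (linearB (bd k.+1)).
by rewrite -[bd k.+1 (bd k.+2 _)]/(bd k.+2.-1 _) (boundaryK (A k.+1 c)) subr0.
Qed.

Lemma homotopy_tail_boundary k c : homotopy_tail k (bd k.+1 c) = 0.
Proof.
case: k c => [|k] c //=.
by rewrite -[chain_boundary _]/(bd k.+1 (bd k.+2 c)) (boundaryK c) linear0.
Qed.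

Lemma boundary_smoothing k c :
  bd k.+1 (@smoothing k.+1 c) = smoothing (bd k.+1 c).
Proof. by rewrite boundary_smoothing_eq /smoothing homotopy_tail_boundary subr0. Qed.

Lemma chain_norm_leB r n k (c d : chain k) : 1 <= r ->
  cnorm r n (c - d) <= cnorm r n c + cnorm r n d.
Proof.
by move=> r1; rewrite -[X in _ <= _ + X](chain_normN _ _ _ r1) chain_normD.
Qed.

(** Both ends of the interval from [p] to [q] are used below as [r]. *)
Section Graph.
Variables (r : R) (r1 : 1 <= r) (pr : p <= r) (rq : r <= q).

Lemma dominated_graph k l (f : chain k -> chain l) :
  dominated (fun n => cnorm q n (k:=k)) (fun n => cnorm p n (k:=l)) f ->
  dominated (graph_norms S r1 k) (fun n => cnorm r n (k:=l)) f.
Proof.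
move=> df; apply: (@dominated_le_comp _ _ _ _ _ (fun n => cnorm p n (k:=l)) _ f idfun).
  by move=> n c; exact: chain_norm_exponent.
apply: (@dominated_comp_le _ _ _ _ _ (fun n => cnorm q n (k:=k)) _ f idfun) df.
move=> n c; apply: le_trans (chain_norm_exponent S r1 rq _ _) _.
by rewrite lerDl chain_norm_ge0.
Qed.

(** The boundary part of the graph norm is controlled through
    [d (A c) = c - (c - d (A c))]; because of the term [c], the exponent of the
    target cannot be smaller than that of the source. *)
Lemma homotopy_dominated k :
  dominated (graph_norms S r1 k) (graph_norms S r1 k.+1) (A k).
Proof.
apply: (@dominated_add _ _ _ _ _ _ _ (fun n => cnorm r n (k:=k.+1))
    (fun n => cnorm r n (k:=k)) _ (A k) (fun c => bd k.+1 (A k c))).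
- by move=> n c; exact: seminorm_ge0.
- by [].
- exact: dominated_graph.
apply: (@dominated_add _ _ _ _ _ _ _ (fun n => cnorm r n (k:=k))
    (fun n => cnorm r n (k:=k)) _ idfun (fun c => c - bd k.+1 (A k c))).
- by move=> n c; exact: seminorm_ge0.
- by move=> n c; rewrite -{1}[bd _ _](subKr c); exact: chain_norm_leB.
- apply: dominated_le => n c; first exact: seminorm_ge0.
  by rewrite lerDl chain_norm_ge0.
- exact: dominated_graph.
Qed.

Lemma homotopy_tail_null k u :
  bd k \o u \in subspace_pred (null (graph_norms S r1 k.-1)) ->
  homotopy_tail k \o u \in subspace_pred (null (graph_norms S r1 k)).
Proof.
case: k u => [|k] u u0; last exact: (dominated_null (@homotopy_dominated k) u0).
by have [] := subspaceP (null (graph_norms S r1 0)).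
Qed.

End Graph.

(** The graph norm of the source provides [d c]: it is needed for the term
    [A (d c)], and for the boundary, which is [(id - d A) (d c)]. *)
Lemma smoothing_dominated k :
  dominated (graph_norms S q1 k) (graph_norms S p1 k) (@smoothing k).
Proof.
have q0 n l (c : chain l) : 0 <= graph_norms S q1 l n c by exact: seminorm_ge0.
have from_graph l m (f : chain l -> chain m) :
    dominated (fun n => cnorm q n (k:=l)) (fun n => cnorm p n (k:=m)) f ->
    dominated (graph_norms S q1 l) (fun n => cnorm p n (k:=m)) f.
  apply: (@dominated_comp_le _ _ _ _ _ (fun n => cnorm q n (k:=l)) _ f idfun).
  by move=> n c; rewrite lerDl chain_norm_ge0.
have from_boundary l m (f : chain l.-1 -> chain m) :
    dominated (fun n => cnorm q n (k:=l.-1)) (fun n => cnorm p n (k:=m)) f ->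
    dominated (graph_norms S q1 l) (fun n => cnorm p n (k:=m)) (f \o bd l).
  apply: dominated_comp_le => n c; by rewrite lerDr chain_norm_ge0.
apply: (@dominated_add _ _ _ _ _ _ _ (fun n => cnorm p n (k:=k))
    (fun n => cnorm p n (k:=k.-1)) _ (@smoothing k) (fun c => bd k (smoothing c))) => //.
- apply: (@dominated_add _ _ _ _ _ _ _ (fun n => cnorm p n (k:=k))
    (fun n => cnorm p n (k:=k)) _ (fun c => c - bd k.+1 (A k c)) (homotopy_tail k)) => //.
  + by move=> n c; exact: chain_norm_leB.
  + exact: from_graph.
  case: k => [|k]; last exact: (from_boundary k.+1 _ _ (@A_dom k)).
  by apply: dominated_le => // n c; rewrite [leLHS]chain_norm0.
have -> : (fun c => bd k (smoothing c)) =
    (fun c => c - bd k.-1.+1 (A k.-1 c)) \o bd k.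
  by apply/funext => c; exact: boundary_smoothing_eq.
exact: from_boundary.
Qed.

Lemma sub_smoothing_boundary k (c : chain k) :
  c - smoothing c - bd k.+1 (A k c) = homotopy_tail k c.
Proof.
rewrite /smoothing; move: (bd _ _) (homotopy_tail _) => x t.
by rewrite !opprB addrCA (addrC c) subrK addrK.
Qed.

Lemma sub_boundary_smoothing k (c : chain k) (d : chain k.+1) :
  c - bd k.+1 (smoothing d + A k c) = smoothing (c - bd k.+1 d) + homotopy_tail k c.
Proof.
rewrite (linearD (bd k.+1)) smoothingB boundary_smoothing.
rewrite -sub_smoothing_boundary.
move: (smoothing c) (smoothing _) (bd k.+1 (A k c)) => x y b.
by rewrite opprD [RHS]addrC -!addrA; congr (_ + _); rewrite addrCA addKr addrC.
Qed.

Local Notation Np := (graph_norms S p1).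
Local Notation Nq := (graph_norms S q1).

Lemma lp_boundary_class (r : R) (r1 : 1 <= r) k u
    (uC : u \in subspace_pred (cauchy (graph_norms S r1 k)))
    (buC : bd k \o u \in subspace_pred (cauchy (graph_norms S r1 k.-1))) :
  lp_boundary S r1 k (limit_class uC) = limit_class buC.
Proof. exact: completion_map_class. Qed.

Lemma boundary_cauchy (r : R) (r1 : 1 <= r) k u :
  u \in subspace_pred (cauchy (graph_norms S r1 k)) ->
  bd k \o u \in subspace_pred (cauchy (graph_norms S r1 k.-1)).
Proof. exact: (seq_map_cauchy (@boundary_continuous R G S r r1 k)). Qed.

Lemma inclusion_cauchy k u : u \in subspace_pred (cauchy (Np k)) ->
  u \in subspace_pred (cauchy (Nq k)).
Proof. exact: (seq_map_cauchy (@id_continuous R G S p q p1 q1 pq k)). Qed.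

Lemma lp_inclusion_class k u (uC : u \in subspace_pred (cauchy (Np k)))
    (uC' : u \in subspace_pred (cauchy (Nq k))) :
  lp_inclusion S p1 q1 pq k (limit_class uC) = limit_class uC'.
Proof. exact: completion_map_class. Qed.

(** A cycle of the completed complex is a limit of chains that need not be
    cycles; only their boundaries tend to 0. *)
Lemma cycle_class (r : R) (r1 : 1 <= r) k (z : submod (ker (lp_boundary S r1 k))) :
  exists u (uC : u \in subspace_pred (cauchy (graph_norms S r1 k))),
    val z = limit_class uC /\
    bd k \o u \in subspace_pred (null (graph_norms S r1 k.-1)).
Proof.
have [u [uC zu]] := limit_classP (val z); exists u, uC; split=> //.
apply/(limit_class_eq0 (boundary_cauchy uC)); rewrite -lp_boundary_class -zu.
exact/eqP/(valP z).
Qed.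

Lemma lp_canonical_pi k (z : submod (ker (lp_boundary S p1 k))) :
  lp_canonical S p1 q1 pq k (subquo_pi (im (lp_boundary S p1 k.+1)) z) =
  subquo_pi (im (lp_boundary S q1 k.+1))
    (submod_map (@lp_inclusion_ker R G S p q p1 q1 pq k) z).
Proof. exact: subquo_map_pi. Qed.

(** If [u] represents a cycle and [u - d v] is null for the exponent [q], then [smoothing v + A u] is a bounding sequence for the exponent [p]: the
    defect is [smoothing (u - d v)] plus the tail [A (d u)], and both are null. *)
Lemma lp_canonical_eq0 k x : lp_canonical S p1 q1 pq k x = 0 -> x = 0.
Proof.
rewrite -[x]subquo_reprK; move: (repr x) => z {x}.
have [u [uC [zu bu0]]] := cycle_class z.
rewrite lp_canonical_pi -[X in _ = X -> _](linear0 (subquo_pi _)).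
move=> /subquo_piP; rewrite /= subr0 => /asboolP[b].
have [v [vC ->]] := limit_classP b.
rewrite zu (lp_inclusion_class _ (inclusion_cauchy uC)).
rewrite (lp_boundary_class _ (boundary_cauchy vC)) => /limit_class_eq uv0.
rewrite -(linear0 (subquo_pi _)); apply/subquo_piP; rewrite /= subr0 zu.
have svC := dominated_cauchy (@smoothing_dominated k.+1) (@smoothingB k.+1) vC.
have AuC := dominated_cauchy (homotopy_dominated p1 (lexx p) pq k)
  (linearB (A k)) uC.
have wC : (@smoothing k.+1 \o v) + (A k \o u) \in subspace_pred (cauchy (Np k.+1)).
  exact: (rpredD svC AuC).
apply/asboolP; exists (limit_class wC).
rewrite (lp_boundary_class _ (boundary_cauchy wC)); apply/limit_class_eq.
have -> : u - (bd k.+1 \o ((@smoothing k.+1 \o v) + (A k \o u))) =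
    (@smoothing k \o (u - (bd k.+1 \o v))) + (homotopy_tail k \o u).
  by apply/funext => i; exact: sub_boundary_smoothing.
apply: rpredD; first exact: (dominated_null (@smoothing_dominated k)).
exact: homotopy_tail_null.
Qed.

(** A cycle [u] for the exponent [q] is homologous to [smoothing u], which lives
    in exponent [p]; they differ by [d (A u)] and the null tail [A (d u)]. *)
Lemma lp_canonical_surjective k y : exists x, lp_canonical S p1 q1 pq k x = y.
Proof.
rewrite -[y]subquo_reprK; move: (repr y) => z {y}.
have [u [uC [zu bu0]]] := cycle_class z.
have suC := dominated_cauchy (@smoothing_dominated k) (@smoothingB k) uC.
have z'ker : limit_class suC \in subspace_pred (ker (lp_boundary S p1 k)).
  apply/eqP; rewrite (lp_boundary_class _ (boundary_cauchy suC)).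
  apply/limit_class_eq0; case: k u {z uC zu suC} bu0 => [|k] u bu0.
    by have [] := subspaceP (null (Np 0)).
  have -> : bd k.+1 \o (@smoothing k.+1 \o u) = @smoothing k \o (bd k.+1 \o u).
    by apply/funext => i; exact: boundary_smoothing.
  exact: (dominated_null (@smoothing_dominated k)).
exists (subquo_pi _ (Submod z'ker)); rewrite lp_canonical_pi.
apply/esym/subquo_piP => /=.
rewrite zu (lp_inclusion_class _ (inclusion_cauchy suC)).
have duC : u - (@smoothing k \o u) \in subspace_pred (cauchy (Nq k)).
  exact: (rpredB uC (inclusion_cauchy suC)).
rewrite (limit_classB _ _ duC).
have AuC := dominated_cauchy (homotopy_dominated q1 pq (lexx q) k)
  (linearB (A k)) uC.
apply/asboolP; exists (limit_class AuC).
rewrite (lp_boundary_class _ (boundary_cauchy AuC)); apply/limit_class_eq.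
have -> : u - (@smoothing k \o u) - (bd k.+1 \o (A k \o u)) = homotopy_tail k \o u.
  by apply/funext => i; exact: sub_smoothing_boundary.
exact: homotopy_tail_null.
Qed.

Lemma lp_canonical_bijective k : bijective (lp_canonical S p1 q1 pq k).
Proof.
have /choice[inv invK] := lp_canonical_surjective (k:=k).
exists inv => [x|y]; last exact: invK.
apply/subr0_eq/lp_canonical_eq0; rewrite linearB; apply/eqP.
by rewrite subr_eq0; apply/eqP; exact: invK.
Qed.

End Homotopy.

Theorem mainTheorem1 (R : realType) (G : groupType) (S : {fset G})
    (S_gen : generates S)
    (G_growth : polynomial_growth S R \/ exponential_growth S R)
    (p q : R) (p_gt1 : 1 < p) (q_gt1 : 1 < q) (pq : p < q) :
  forall k : nat, bijective (lp_canonical S (ltW p_gt1) (ltW q_gt1) (ltW pq) k).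
Proof.
move=> k; have p1 := ltW p_gt1; have q1 := ltW q_gt1.
have [A tameA] := smoothing_exists S_gen p_gt1 G_growth.
have A_dom l : dominated (fun n => chain_norm S q n (k:=l))
    (fun n => chain_norm S p n (k:=l.+1)) (A l).
  by apply: tame_dominated => //; exact: (tameA l).1.
have B_dom l : dominated (fun n => chain_norm S q n (k:=l))
    (fun n => chain_norm S p n (k:=l)) (fun c => c - boundary R G l.+1 (A l c)).
  have [_ tB] := tameA l.
  exact: (@tame_dominated _ _ _ S_gen p q l l
    (idfun \- (boundary R G l.+1 \o A l)) p1 q1 tB).
exact: lp_canonical_bijective A_dom B_dom k.
Qed.
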